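(* Let $\Omega\subset\mathbb{R}^d$ be compact and satisfy an interior cone condition, let $k\ge1$, let $X_n=\{x_1,\dots,x_n\}$ be an i.i.d. sample of size $n$ from a nicely behaving distribution on $\Omega$ with fill distance $h_n$, let $f:\mathbb{R}^d\to\mathbb{R}$ and $F_n=(f(x_1),\dots,f(x_n))$, and let $s_{F_n,X_n}^{\mathrm{MLS}}$ be the degree $k-1$ MLS approximation with weight $\theta_h\in\mathcal{C}^k$, $h=h_n$. Then for every fixed $x_0\in\Omega$ there exist a radius $\delta_0\asymp h_n$ (that is, $a h_n\le\delta_0\le b h_n$ with constants $0<a\le b$ independent of $n$) and a positive constant $\phi$ such that, conditionally on the event $\mathscr{E}_I$ (taken at $\hat x=x_0$), $$P\Big(s_{F_n,X_n}^{\mathrm{MLS}}\in\mathcal{C}^k\big(B(x_0,\delta_0)\big)\,\Big|\,\mathscr{E}_I\Big)\ge1-\frac{2A^2}{n^{\phi}},$$ where $A$ is the number of multi-indices $\alpha\in\mathbb{Z}_{\ge0}^d$ with $|\alpha|\le k-1$.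
   Context: Interior cone condition: there exist an angle $\vartheta\in(0,\pi/2)$ and a radius $r>0$ such that for every $x\in\Omega$ there is a unit vector $\xi(x)$ for which the cone $\{x+\lambda y: y\in\mathbb{R}^d,\ \|y\|_2=1,\ y^T\xi(x)\ge\cos\vartheta,\ \lambda\in[0,r]\}$ is contained in $\Omega$. Nicely behaving distribution: a probability distribution on $\Omega$ with a density $p$, $p(x)>0$ for all $x\in\Omega$, for which there are constants $0<\underline{c}\le\bar{c}<\infty$ such that $p$ lies between $\underline{c}$ and $\bar c$ times the uniform probability density on $\Omega$. Fill distance: $h_n=\sup_{x\in\Omega}\min_{1\le i\le n}\|x-x_i\|$. $B(x,\rho)$ denotes the ball $\{y\in\mathbb{R}^d:\|y-x\|\le\rho\}$. Weight: fix $s>0$ and $\Phi\in\mathcal{C}^k(\mathbb{R}^d)$, nonnegative, supported in $B(0,s)$ and positive in its interior; put $\theta_h(x)=\Phi(x/h)$ with $h=h_n$. MLS approximation: $\Pi_{k-1}^d$ is the space of polynomials on $\mathbb{R}^d$ of total degree at most $k-1$. For $\xi\in\mathbb{R}^d$ let $p_\xi^*=\operatorname{argmin}_{p\in\Pi_{k-1}^d}\sum_{i=1}^n(p(x_i)-f(x_i))^2\,\theta_h(\xi-x_i)$, and $s_{F_n,X_n}^{\mathrm{MLS}}(\xi)=p_\xi^*(\xi)$. The event that $s_{F_n,X_n}^{\mathrm{MLS}}\in\mathcal{C}^k(B(x_0,\delta_0))$ includes that the minimizer is unique for every $\xi\in B(x_0,\delta_0)$. Event $\mathscr{E}_I$ at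 a point $\hat x\in\Omega$: $\mathscr{E}_I=\{\#I_{B(\hat x,sh_n)}\in[\gamma_1\log n,\gamma_2\log n]\}$, where $I_{B(\hat x,sh_n)}=\{i: x_i\in B(\hat x,sh_n)\}$ and $0<\gamma_1\le\gamma_2$ are fixed constants, independent of $n$ and $\hat x$, for which $P(\mathscr{E}_I)\ge1-2/n^{c}$ with some constant $c>0$. Conditional probabilities are considered for $n$ with $P(\mathscr{E}_I)>0$. *)

(* Defs.v *)
From HB Require Import structures.
From mathcomp Require Import all_boot all_order all_algebra.
From mathcomp Require Import all_classical all_reals all_analysis.

Set Implicit Arguments.
Unset Strict Implicit.
Unset Printing Implicit Defensive.
Import Order.TTheory GRing.Theory Num.Theory.
Import numFieldNormedType.Exports.
Local Open Scope classical_set_scope.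
Local Open Scope ring_scope.

(* R^d is ['rV[R]_d]; its topology is the library's one (the library norm on
   matrices is the sup norm), Euclidean lengths are [enorm]. *)

Section borel_matrix.
Variables (R : realType) (m n : nat).

Definition borel_mx : set (set 'M[R]_(m, n)) := <<s open >>.

Let borel_mx0 : borel_mx set0. Proof. exact: sigma_algebra0. Qed.
Let borel_mxC A : borel_mx A -> borel_mx (~` A).
Proof. exact: sigma_algebraC. Qed.
Let borel_mx_bigcup (F : (set 'M[R]_(m, n))^nat) :
  (forall i, borel_mx (F i)) -> borel_mx (\bigcup_i F i).
Proof. exact: sigma_algebra_bigcup. Qed.

Definition borel_mx_display : measure_display.
Proof. exact: default_measure_display. Qed.

HB.instance Definition _ := @isMeasurable.Build borel_mx_display
  'M[R]_(m, n) borel_mx borel_mx0 borel_mxC borel_mx_bigcup.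
End borel_matrix.

Section lebesgue_tuple.
Variable R : realType.

Definition tcons n (xv : measurableTypeR R * n.-tuple R) : n.+1.-tuple R :=
  [tuple of xv.1 :: xv.2].

Lemma measurable_tcons n : measurable_fun setT (@tcons n).
Proof. by apply: measurable_cons => //; exact: measurable_fst. Qed.

HB.instance Definition _ n :=
  isMeasurableFun.Build _ _ _ _ (@tcons n) (@measurable_tcons n).

Section step.
Variables (n : nat) (m : {sigma_finite_measure set (n.-tuple R) -> \bar R}).

Definition lebesgue_cons : set (n.+1.-tuple R) -> \bar R :=
  pushforward (@lebesgue_measure R \x m)%E (@tcons n).

Let lc0 : lebesgue_cons set0 = 0%E. Proof. exact: measure0. Qed.
Let lc_ge0 A : (0 <= lebesgue_cons A)%E. Proof. exact: measure_ge0. Qed.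
Let lc_sigma_additive : semi_sigma_additive lebesgue_cons.
Proof. exact: measure_semi_sigma_additive. Qed.
HB.instance Definition _ :=
  isMeasure.Build _ _ _ lebesgue_cons lc0 lc_ge0 lc_sigma_additive.

Let lc_sigma_finite : sigma_finite setT lebesgue_cons.
Proof.
have [F FT Foo] : sigma_finite setT (@lebesgue_measure R \x m)%E.
  have /sigma_finiteP[F [TF ndF Foo]] := sigma_finiteT (@lebesgue_measure R).
  have /sigma_finiteP[G [TG ndG Goo]] := sigma_finiteT m.
  exists (fun n => F n `*` G n).
    rewrite -setXTT TF TG predeqE => -[x y]; split.
      move=> [/= [i _ Fnx] [k _ Gky]]; exists (maxn i k) => //; split.
      - by move: x Fnx; exact/subsetPset/ndF/leq_maxl.
      - by move: y Gky; exact/subsetPset/ndG/leq_maxr.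
    by move=> [i _ []/= ? ?]; split; exists i.
  move=> k; have [? ?] := Foo k; have [? ?] := Goo k.
  split; first exact: measurableX.
  by rewrite product_measure1E// lte_mul_pinfty// ge0_fin_numE.
pose u (t : n.+1.-tuple R) : measurableTypeR R * n.-tuple R :=
  (thead t, [tuple of behead t]).
have uK : cancel u (@tcons n) by move=> t; rewrite /tcons/= -tuple_eta.
have tK : cancel (@tcons n) u.
  by move=> [x v]; rewrite /u/= theadE; congr pair; exact/val_inj.
have mu : measurable_fun setT u.
  apply/measurable_fun_pairP; split; last exact: measurable_behead.
  exact: measurable_tnth.
exists (fun k => u @^-1` F k); first by rewrite -preimage_bigcup -FT preimage_setT.
move=> k; have [mF Fk] := Foo k; split.
  by rewrite -[X in measurable X]setTI; exact: mu.
rewrite /lebesgue_cons /pushforward -comp_preimage.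
by rewrite (_ : u \o @tcons n = id) //; apply/funext => x; exact: tK.
Qed.
HB.instance Definition _ :=
  Measure_isSigmaFinite.Build _ _ _ lebesgue_cons lc_sigma_finite.
End step.

Fixpoint lebesgue_tuple n : {sigma_finite_measure set (n.-tuple R) -> \bar R} :=
  if n is n'.+1 then lebesgue_cons (lebesgue_tuple n') else \d_([tuple]).

Lemma measurable_tuple_box n (A : 'I_n -> set R) :
  (forall i, measurable (A i)) ->
  measurable [set t : n.-tuple R | forall i, A i (tnth t i)].
Proof.
move=> mA; rewrite (_ : mkset _ =
    \bigcap_(i in setT) ((fun t : n.-tuple R => tnth t i) @^-1` A i)).
  apply: fin_bigcap_measurable => // i _.
  by rewrite -[X in measurable X]setTI; exact: measurable_tnth.
by apply/seteqP; split => [t h i _|t h i]; exact: h.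
Qed.

Lemma lebesgue_tuple_box n (A : 'I_n -> set R) :
  (forall i, measurable (A i)) ->
  lebesgue_tuple n [set t | forall i, A i (tnth t i)] =
  (\prod_(i < n) lebesgue_measure (A i))%E.
Proof.
elim: n A => [|n IH] A mA.
  rewrite big_ord0/= diracE mem_set//; first by case.
rewrite big_ord_recl /= /lebesgue_cons /pushforward.
have -> : @tcons n @^-1` [set t | forall i, A i (tnth t i)] =
   A ord0 `*` [set t : n.-tuple R | forall i, A (lift ord0 i) (tnth t i)].
  apply/seteqP; split => [[x v] /= h|[x v] /= [h0 h] i].
    split; first exact: (h ord0).
    by move=> i; have := h (lift ord0 i); rewrite tnthS.
  have [j ->|->] := unliftP ord0 i; last by [].
  by rewrite tnthS.
have mA0 : measurable (A ord0 : set (measurableTypeR R)) := mA ord0.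
have mB : measurable
    [set t : n.-tuple R | forall i, A (lift ord0 i) (tnth t i)].
  by apply: (@measurable_tuple_box n (fun i => A (lift ord0 i))) => i; exact: mA.
rewrite (product_measure1E _ _ mA0 mB).
by rewrite (IH (fun i => A (lift ord0 i))).
Qed.
End lebesgue_tuple.

Section lebesgue_rV.
Variables (R : realType) (d : nat).

Definition rV_of_tuple (t : d.-tuple R) : 'rV[R]_d := \row_i tnth t i.

Lemma measurable_rV_of_tuple : measurable_fun setT rV_of_tuple.
Proof.
refine (@measurability _ _ _ _ setT rV_of_tuple
  (@open _ : set (set 'rV[R]_d)) erefl _).
move=> _ [U oU <-]; rewrite setTI.
pose box (qr : d.-tuple rat * rat) := [set t : d.-tuple R |
  forall i, ball (ratr (tnth qr.1 i) : R) (ratr qr.2) (tnth t i)].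
pose D := [set qr | box qr `<=` rV_of_tuple @^-1` U].
rewrite (_ : _ @^-1` U = \bigcup_qr (if qr \in D then box qr else set0)).
  apply: countable_bigcupT_measurable => [|qr]; first exact: countableP.
  case: ifPn => // _.
  apply: (@measurable_tuple_box _ _ (fun i => ball (ratr (tnth qr.1 i) : R) _)).
  by move=> i; rewrite ball_itv; exact: measurable_itv.
apply/seteqP; split => [t /= Ut|t [qr _]]; last first.
  by case: ifPn => // /set_mem; exact.
have /nbhs_ballP[e /= e0 eU] : nbhs (rV_of_tuple t) U by exact: open_nbhs_nbhs.
have /rat_in_itvoo[r] : 0 < e / 2 by rewrite divr_gt0.
rewrite in_itv/= => /andP[r0 re].
have /choice[q qP] i : exists q : rat, `|ratr q - tnth t i| < ratr r :> R.
  have /rat_in_itvoo[q] : tnth t i - ratr r < tnth t i + ratr r.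
    by rewrite ltrD2l (lt_trans _ r0)// oppr_lt0.
  by rewrite in_itv/= => qi; exists q; rewrite ltr_distl.
exists ([tuple q i | i < d], r) => //; rewrite mem_set => [i/=|s /= sq].
  by rewrite tnth_mktuple; exact: qP.
apply: eU; split => // i j; rewrite !mxE /ball/=.
have := sq j; rewrite tnth_mktuple /ball/= => sqj.
rewrite (splitr e) (le_lt_trans (ler_distD (ratr (q j)) _ _))// ltrD//.
  by rewrite distrC (lt_trans (qP j)).
exact: lt_trans sqj re.
Qed.

HB.instance Definition _ :=
  isMeasurableFun.Build _ _ _ _ rV_of_tuple measurable_rV_of_tuple.

Definition lebesgue_rV : set 'rV[R]_d -> \bar R :=
  pushforward (@lebesgue_tuple R d) rV_of_tuple.

Let lrV0 : lebesgue_rV set0 = 0%E. Proof. exact: measure0. Qed.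
Let lrV_ge0 A : (0 <= lebesgue_rV A)%E. Proof. exact: measure_ge0. Qed.
Let lrV_sigma_additive : semi_sigma_additive lebesgue_rV.
Proof. exact: measure_semi_sigma_additive. Qed.
HB.instance Definition _ :=
  isMeasure.Build _ _ _ lebesgue_rV lrV0 lrV_ge0 lrV_sigma_additive.

Lemma lebesgue_rV_box (A : 'I_d -> set R) :
  (forall i, measurable (A i)) ->
  lebesgue_rV [set x | forall i, A i (x ord0 i)] =
  (\prod_(i < d) lebesgue_measure (A i))%E.
Proof.
move=> mA; rewrite -lebesgue_tuple_box// /lebesgue_rV /pushforward.
congr (_ _); apply/seteqP; split => t /= h i; have := h i; by rewrite mxE.
Qed.
End lebesgue_rV.

Section euclidean.
Variables (R : realType) (d : nat).
Implicit Types (x y : 'rV[R]_d) (Omega : set 'rV[R]_d).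

Definition edot x y : R := \sum_(i < d) x ord0 i * y ord0 i.
Definition enorm x : R := Num.sqrt (edot x x).
Definition eball x (rho : R) : set 'rV[R]_d := [set y | enorm (y - x) <= rho].

Definition interior_cone Omega : Prop :=
  exists theta r : R, [/\ 0 < theta, theta < pi / 2, 0 < r &
    forall x, Omega x -> exists2 xi, enorm xi = 1 &
      forall y (lambda : R), enorm y = 1 -> cos theta <= edot y xi ->
        0 <= lambda <= r -> Omega (x + lambda *: y)].

(* [mu] lives on R^d and is carried by [Omega]; the uniform density on [Omega]
   is the constant [(fine (lebesgue_rV Omega))^-1]. *)
Definition nicely_behaving Omega (mu : probability 'rV[R]_d R) : Prop :=
  exists p : 'rV[R]_d -> R,
    [/\ measurable_fun Omega p,
        (forall x, Omega x -> 0 < p x),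
        (forall S, measurable S ->
           mu S = (\int[lebesgue_rV (d := d)]_(x in S `&` Omega) (p x)%:E)%E) &
        exists c_lo c_up : R, [/\ 0 < c_lo, c_lo <= c_up &
          forall x, Omega x ->
            c_lo * (fine (lebesgue_rV Omega))^-1 <= p x
              <= c_up * (fine (lebesgue_rV Omega))^-1]].

(* The infimum ranges over a finite set, nonempty when [0 < n]: it is the
   minimum over the sites. *)
Definition fill_distance Omega n (X : 'I_n -> 'rV[R]_d) : R :=
  sup [set inf (range (fun i => enorm (x - X i))) | x in Omega].

Definition basis_vec (i : 'I_d) : 'rV[R]_d := delta_mx ord0 i.

(* f is of class C^k on U, meant for open U: all partial derivatives of order
   at most k exist and are continuous at the points of U. *)
Fixpoint Ck (k : nat) (U : set 'rV[R]_d) (f : 'rV[R]_d -> R) : Prop :=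
  (forall x, U x -> {for x, continuous f}) /\
  (if k is k'.+1 then
     forall i : 'I_d, (forall x, U x -> derivable f x (basis_vec i)) /\
       Ck k' U (fun x => 'D_(basis_vec i) f x)
   else True).

(* f is of class C^k on a set K that need not be open: f agrees on K with a
   C^k function on an open neighbourhood of K. *)
Definition Ck_on (k : nat) (K : set 'rV[R]_d) (f : 'rV[R]_d -> R) : Prop :=
  exists (U : set 'rV[R]_d) (g : 'rV[R]_d -> R),
    [/\ open U, K `<=` U, Ck k U g & forall x, K x -> g x = f x].

(* Multi-indices alpha with |alpha| <= m; the bound forces every entry below
   m.+1. *)
Definition multi_indices (m : nat) : {set {ffun 'I_d -> 'I_m.+1}} :=
  [set a : {ffun 'I_d -> 'I_m.+1} | (\sum_(i < d) a i <= m)%N].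

Definition poly_space (m : nat) : set ('rV[R]_d -> R) :=
  [set p | exists c : {ffun 'I_d -> 'I_m.+1} -> R, forall x,
     p x = \sum_(a in multi_indices m) c a * \prod_(i < d) x ord0 i ^+ a i].

Section mls.
Variables (m n : nat) (theta : 'rV[R]_d -> R) (X : 'I_n -> 'rV[R]_d)
  (f : 'rV[R]_d -> R).

Definition mls_objective (xi : 'rV[R]_d) (p : 'rV[R]_d -> R) : R :=
  \sum_(i < n) (p (X i) - f (X i)) ^+ 2 * theta (xi - X i).

Definition mls_argmin (xi : 'rV[R]_d) : set ('rV[R]_d -> R) :=
  [set p | poly_space m p /\
     forall q, poly_space m q -> mls_objective xi p <= mls_objective xi q].

(* Only meaningful where [mls_argmin xi] is a singleton. *)
Definition mls (xi : 'rV[R]_d) : R := xget (fun=> 0) (mls_argmin xi) xi.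

Definition mls_smooth_on (k : nat) (K : set 'rV[R]_d) : Prop :=
  (forall xi, K xi -> exists! p, mls_argmin xi p) /\ Ck_on k K mls.
End mls.

(* theta_h(x) = Phi(x / h). *)
Definition scaled_weight (Phi : 'rV[R]_d -> R) (h : R) (x : 'rV[R]_d) : R :=
  Phi (h^-1 *: x).

Definition admissible_weight (k : nat) (s : R) (Phi : 'rV[R]_d -> R) : Prop :=
  [/\ Ck k setT Phi, (forall x, 0 <= Phi x),
      (forall x, Phi x != 0 -> enorm x <= s) &
      (forall x, enorm x < s -> 0 < Phi x)].

Definition sites_in n (X : 'I_n -> 'rV[R]_d) (K : set 'rV[R]_d) : {set 'I_n} :=
  [set i | X i \in K].

End euclidean.

Section sampling.
Variables (R : realType) (d : nat) (dT : measure_display)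
  (T : measurableType dT) (P : probability T R).

Definition iid_sample n (X : 'I_n -> {RV P >-> 'rV[R]_d})
    (mu : probability 'rV[R]_d R) : Prop :=
  (forall i B, measurable B -> distribution P (X i) B = mu B) /\
  (forall B : 'I_n -> set 'rV[R]_d, (forall i, measurable (B i)) ->
     P [set w | forall i, B i (X i w)] =
     (\prod_(i < n) P (X i @^-1` B i))%E).

Definition cond_prob (A B : set T) : R := fine (P (A `&` B)) / fine (P B).

Definition sample n (X : 'I_n -> {RV P >-> 'rV[R]_d}) (w : T) :
  'I_n -> 'rV[R]_d := fun i => X i w.

Definition event_I n (X : 'I_n -> {RV P >-> 'rV[R]_d})
    (Omega : set 'rV[R]_d) (s gamma1 gamma2 : R) (xhat : 'rV[R]_d) : set T :=
  [set w | let h := fill_distance Omega (sample X w) in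
     gamma1 * ln n%:R <= #|sites_in (sample X w) (eball xhat (s * h))|%:R
       <= gamma2 * ln n%:R].

Definition event_smooth n (X : 'I_n -> {RV P >-> 'rV[R]_d})
    (Omega : set 'rV[R]_d) (Phi f : 'rV[R]_d -> R) (k : nat)
    (x0 : 'rV[R]_d) (delta0 : T -> R) : set T :=
  [set w | let h := fill_distance Omega (sample X w) in
     mls_smooth_on k.-1 (scaled_weight Phi h) (sample X w) f k
       (eball x0 (delta0 w))].

End sampling.

(* Main.v *)
Require Import Defs.
From mathcomp Require Import all_boot all_order all_algebra.
From mathcomp Require Import all_classical all_reals all_analysis.
From mathcomp Require Import measurable_realfun ring lra.
Import Order.TTheory GRing.Theory Num.Theory.
Import numFieldNormedType.Exports.
Set Implicit Arguments.
Unset Strict Implicit.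
Unset Printing Implicit Defensive.
Local Open Scope classical_set_scope.
Local Open Scope ring_scope.

(** Write B for the monomial basis and G(xi) for the Gram matrix of B at the
    sites, weighted by theta_h(xi - x_i).  The minimizer at xi is unique iff
    det G(xi) <> 0, and Cramer's rule then makes the approximation C^k near xi.
    So the event says that det G does not vanish on the compact ball, which is
    a countable condition, and det G(xi) <> 0 as soon as the sites at distance
    less than s h from xi are unisolvent.

    Take delta_0 = s h / 4 and a deterministic scale h0 with
    h0^d = eps log n / n.  A fixed grid in the open part of the cone at x_0 is
    unisolvent and stays so when each node moves in a small box; this is
    invariant under y |-> x_0 + h0 y.  Hence, if h >= h0 and each scaled box
    contains a site, the event holds.  A scaled box is missed with probability
    at most exp (- c4 log n).  If instead h < h0, then on E_I the ball
    B(x_0, s h0) contains at least gamma_1 log n sites, although only a small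
    multiple of log n is expected there: by Markov's inequality for exp(#sites)
    this has probability at most n^(- gamma_1 / 2).  No separate estimate of the
    fill distance is needed. *)

(** * Gram matrices *)

Section gram.
Variables (R : realFieldType) (n A : nat).
Implicit Types (w : 'I_n -> R) (M : 'M[R]_(n, A)) (v : 'rV[R]_A).

Definition gram w M : 'M[R]_A := \matrix_(j, l) \sum_i w i * (M i j * M i l).

Lemma mul_gramE w M v l :
  (v *m gram w M) ord0 l = \sum_i w i * ((v *m M^T) ord0 i * M i l).
Proof.
rewrite mxE; under eq_bigr do rewrite mxE mulr_sumr.
rewrite exchange_big; apply: eq_bigr => i _ /=.
rewrite mxE mulr_suml mulr_sumr; apply: eq_bigr => j _.
by rewrite mxE; ring.
Qed.

Lemma gram_quadE w M v :
  \sum_l (v *m gram w M) ord0 l * v ord0 l =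
  \sum_i w i * (v *m M^T) ord0 i ^+ 2.
Proof.
under eq_bigr do rewrite mul_gramE mulr_suml.
rewrite exchange_big; apply: eq_bigr => i _ /=.
rewrite expr2 [X in _ = _ * (_ * X)]mxE !mulr_sumr.
by apply: eq_bigr => l _; rewrite [M^T _ _]mxE; ring.
Qed.

(** The quadratic form of [gram w M] at [v] is the weighted sum of the squares of the entries of
    [v *m M^T]. With nonnegative weights a kernel vector annihilates every term separately. *)
Lemma det_gram_neq0 w M : (forall i, 0 <= w i) ->
  (\det (gram w M) != 0) <->
  (forall v, (forall i, w i * (v *m M^T) ord0 i = 0) -> v = 0).
Proof.
move=> w0; split=> [detN0 v vM|inj].
  have : v *m gram w M = 0.
    apply/rowP => l; rewrite mul_gramE mxE big1// => i _.
    by rewrite mulrA vM mul0r.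
  move=> /(congr1 (mulmxr (invmx (gram w M)))); rewrite /= mul0mx mulmxK//.
  by rewrite unitmxE unitfE.
apply/negP => /det0P[v vN0 vG]; move/eqP: vN0; apply; apply: inj => i.
have : \sum_i w i * (v *m M^T) ord0 i ^+ 2 = 0.
  by rewrite -gram_quadE vG big1// => l _; rewrite mxE mul0r.
move/eqP; rewrite psumr_eq0 => [|{}i _]; last by rewrite mulr_ge0// sqr_ge0.
move/allP/(_ i (mem_index_enum i)) => /=.
by rewrite mulf_eq0 expf_eq0/= -mulf_eq0 => /eqP.
Qed.
End gram.

(** * Rings of functions are stable under determinants and adjugates *)

Section function_ring.
Variables (R : comNzRingType) (X : Type) (Q : (X -> R) -> Prop).
Hypotheses (Qc : forall c, Q (fun=> c))
  (QD : forall f g, Q f -> Q g -> Q (fun x => f x + g x))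
  (QM : forall f g, Q f -> Q g -> Q (fun x => f x * g x)).

Lemma fun_ring_sum (I : Type) (r : seq I) (P : pred I) (F : I -> X -> R) :
  (forall i, Q (F i)) -> Q (fun x => \sum_(i <- r | P i) F i x).
Proof.
move=> QF; elim: r => [|i r IH].
  rewrite (_ : (fun _ => _) = fun=> 0)//.
  by apply/funext => x; rewrite big_nil.
rewrite (_ : (fun _ => _) = fun x =>
    (if P i then F i x else 0) + \sum_(i <- r | P i) F i x); last first.
  by apply/funext => x; rewrite big_cons; case: ifP; rewrite ?add0r.
by apply: QD IH; case: (P i).
Qed.

Lemma fun_ring_prod (I : Type) (r : seq I) (P : pred I) (F : I -> X -> R) :
  (forall i, Q (F i)) -> Q (fun x => \prod_(i <- r | P i) F i x).
Proof.
move=> QF; elim: r => [|i r IH].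
  rewrite (_ : (fun _ => _) = fun=> 1)//.
  by apply/funext => x; rewrite big_nil.
rewrite (_ : (fun _ => _) = fun x =>
    (if P i then F i x else 1) * \prod_(i <- r | P i) F i x); last first.
  by apply/funext => x; rewrite big_cons; case: ifP; rewrite ?mul1r.
by apply: QM IH; case: (P i).
Qed.

(** Used with [Q] the class C^k on an open set, continuity at a point, and measurability. *)
Lemma fun_ring_det m (F : X -> 'M[R]_m) :
  (forall i j, Q (fun x => F x i j)) -> Q (fun x => \det (F x)).
Proof.
move=> QF; rewrite /determinant; apply: fun_ring_sum => s.
by apply: QM => //; apply: fun_ring_prod.
Qed.

Lemma fun_ring_adj m (F : X -> 'M[R]_m) i j :
  (forall i j, Q (fun x => F x i j)) -> Q (fun x => (\adj (F x)) i j).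
Proof.
move=> QF; under eq_fun do rewrite mxE /cofactor.
apply: QM => //; apply: fun_ring_det => i' j'.
by under eq_fun do rewrite !mxE.
Qed.
End function_ring.

(** * Polynomials *)

Section polynomials.
Variables (R : realType) (d m : nat).
Local Notation A := #|multi_indices d m|.

Lemma card_multi_indices_gt0 : (0 < A)%N.
Proof.
by apply/card_gt0P; exists [ffun=> ord0]; rewrite inE big1// => i _; rewrite ffunE.
Qed.

Definition exponent (j : 'I_A) : {ffun 'I_d -> 'I_m.+1} := enum_val j.

Definition monomials (x : 'rV[R]_d) : 'rV[R]_A :=
  \row_j \prod_(i < d) x ord0 i ^+ (exponent j i).

Definition mpol (v : 'rV[R]_A) (x : 'rV[R]_d) : R :=
  \sum_j v ord0 j * monomials x ord0 j.

Lemma mpolD u v x : mpol (u + v) x = mpol u x + mpol v x.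
Proof. by rewrite -big_split/=; apply: eq_bigr => j _; rewrite mxE mulrDl. Qed.

Lemma mpolB u v x : mpol (u - v) x = mpol u x - mpol v x.
Proof. by rewrite -sumrB; apply: eq_bigr => j _; rewrite !mxE mulrBl. Qed.

Lemma mpol0 x : mpol 0 x = 0.
Proof. by rewrite /mpol big1// => j _; rewrite mxE mul0r. Qed.

Lemma poly_spaceP p : poly_space m p <-> exists v, p = mpol v.
Proof.
split=> [[c cE]|[v ->]].
  exists (\row_j c (exponent j)); apply/funext => x.
  by rewrite cE big_enum_val; apply: eq_bigr => j _; rewrite !mxE.
(* [enum_rank_in] wants a member of the set to supply its default; the sum runs over multi-indices
   only, so the default is never read. *)
pose j0 := Ordinal card_multi_indices_gt0.
exists (fun a => v ord0 (enum_rank_in (enum_valP j0) a)) => x.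
rewrite [RHS]big_enum_val; apply: eq_bigr => j _.
by rewrite !mxE enum_valK_in.
Qed.

(* The coefficients are recovered by applying, in each variable, the inverse of
   the Vandermonde matrix of the grid coordinates. *)
Lemma mpol_grid_inj (t : 'I_d -> 'I_m.+1 -> R) v : (forall i, injective (t i)) ->
  (forall L : {ffun 'I_d -> 'I_m.+1}, mpol v (\row_i t i (L i)) = 0) -> v = 0.
Proof.
move=> tI v0; pose V i : 'M[R]_m.+1 := Vandermonde m.+1 (\row_l t i l).
have VU i : V i \in unitmx.
  rewrite unitmxE unitfE det_Vandermonde; apply/prodf_neq0 => a _.
  apply/prodf_neq0 => b ab; rewrite !mxE subr_eq0.
  by apply: contraTneq ab => /tI ->; rewrite ltnn.
apply/rowP => k; rewrite mxE.
transitivity (\sum_(L : {ffun 'I_d -> 'I_m.+1}) mpol v (\row_i t i (L i)) *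
    \prod_i invmx (V i) (L i) (exponent k i)); last first.
  by rewrite big1// => L _; rewrite v0 mul0r.
under eq_bigr do rewrite mulr_suml.
(* By distributivity the inner sum over the grid is the product over [i] of the entries of
   [V i *m invmx (V i)] at [exponent j i], [exponent k i]: it is 1 for [j = k] and 0 otherwise. *)
rewrite exchange_big/= (bigD1 k)//= [X in _ = _ + X]big1 ?addr0 => [|j jk].
  transitivity (v ord0 k * \prod_(i < d) (V i *m invmx (V i))
      (exponent k i) (exponent k i)).
    by rewrite big1 ?mulr1// => i _; rewrite mulmxV// mxE eqxx.
  under [in LHS]eq_bigr do rewrite mxE.
  rewrite bigA_distr_bigA mulr_sumr; apply: eq_bigr => L _ /=.
  rewrite -mulrA /monomials mxE -big_split; congr (_ * _); apply: eq_bigr => i _ /=.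
  by rewrite !mxE.
transitivity (v ord0 j * \prod_(i < d) (V i *m invmx (V i))
    (exponent j i) (exponent k i)).
  under [in RHS]eq_bigr do rewrite mxE.
  rewrite bigA_distr_bigA mulr_sumr; apply: eq_bigr => L _ /=.
  rewrite -mulrA /monomials mxE -big_split; congr (_ * _); apply: eq_bigr => i _ /=.
  by rewrite !mxE.
have [i ji] : exists i, exponent j i != exponent k i.
  apply/existsP; apply: contraR jk; rewrite negb_exists => /forallP jk.
  apply/eqP/enum_val_inj/ffunP => i; apply/eqP.
  by have := jk i; rewrite negbK.
by rewrite (bigD1 i)//= mulmxV// mxE (negbTE ji) mul0r mulr0.
Qed.

(** The integer grid with coordinates from 0 to [m] already determines the coefficients. *)
Lemma mpol_inj : injective mpol.
Proof.
move=> u v uv; apply/eqP; rewrite -subr_eq0; apply/eqP.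
apply: (@mpol_grid_inj (fun _ l => (l : nat)%:R)) => [i a b|L].
  by move=> /eqP; rewrite eqr_nat => /eqP/val_inj.
by rewrite mpolB uv subrr.
Qed.

(** Polynomials of degree at most [j], written with exponents bounded by [m]. Keeping [j] apart from
    [m] lets the degree grow factor by factor in an induction. *)
Let span (j : nat) (p : 'rV[R]_d -> R) :=
  exists2 c : {ffun 'I_d -> 'I_m.+1} -> R,
    (forall a, c a != 0 -> (\sum_(i < d) a i <= j)%N) &
    forall x, p x = \sum_a c a * \prod_(i < d) x ord0 i ^+ a i.

Let spanD j p q : span j p -> span j q -> span j (fun x => p x + q x).
Proof.
move=> [b b0 bE] [c c0 cE]; exists (fun a => b a + c a) => [a|x].
  have [ba|/b0//] := eqVneq (b a) 0.
  by rewrite ba add0r => /c0.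
by rewrite bE cE -big_split; apply: eq_bigr => a _; rewrite mulrDl.
Qed.

Let spanZ j k p : span j p -> span j (fun x => k * p x).
Proof.
move=> [b b0 bE]; exists (fun a => k * b a) => [a|x].
  by rewrite mulf_eq0 negb_or => /andP[_ /b0].
by rewrite bE mulr_sumr; apply: eq_bigr => a _; rewrite mulrA.
Qed.

Let span_sum j (I : finType) (F : I -> 'rV[R]_d -> R) :
  (forall i, span j (F i)) -> span j (fun x => \sum_i F i x).
Proof.
move=> FP; rewrite /index_enum; elim: (Finite.enum I) => [|i r IH].
  exists (fun=> 0) => [a|x]; first by rewrite eqxx.
  by rewrite big_nil big1// => a _; rewrite mul0r.
have := spanD (FP i) IH; congr span; apply/funext => x.
by rewrite big_cons.
Qed.

Let span_monomial j (a : {ffun 'I_d -> 'I_m.+1}) : (\sum_(i < d) a i <= j)%N ->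
  span j (fun x => \prod_(i < d) x ord0 i ^+ a i).
Proof.
move=> aj; exists (fun b => (b == a)%:R) => [b|x].
  by rewrite pnatr_eq0 eqb0 negbK => /eqP ->.
rewrite (bigD1 a)//= eqxx mul1r [X in _ + X]big1 ?addr0// => b /negbTE ->.
by rewrite mul0r.
Qed.

Let span_mulX j p i : (j < m)%N -> span j p ->
  span j.+1 (fun x => x ord0 i * p x).
Proof.
move=> jm [c c0 cE].
have -> : (fun x : 'rV[R]_d => x ord0 i * p x) = fun x => \sum_a c a *
    (x ord0 i * \prod_(k < d) x ord0 k ^+ (a k)).
  apply/funext => x; rewrite cE mulr_sumr; apply: eq_bigr => a _.
  by rewrite mulrCA.
apply: span_sum => a; have [ca|/c0 aj] := eqVneq (c a) 0.
  exists (fun=> 0) => [b|x]; first by rewrite eqxx.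
  by rewrite ca mul0r big1// => b _; rewrite mul0r.
apply: spanZ.
(* Raising one exponent stays within the bound since the total degree is at most [j < m], so [inord]
   never truncates. *)
pose b := [ffun k => inord (a k + (k == i))%N : 'I_m.+1].
have bE k : b k = (a k + (k == i))%N :> nat.
  rewrite ffunE inordK// ltnS.
  apply: (@leq_trans (\sum_(l < d) a l).+1).
    by rewrite -[X in (_ <= X)%N]addn1 leq_add ?leq_b1// (bigD1 k)//= leq_addr.
  exact: leq_ltn_trans aj jm.
have -> : (fun x : 'rV[R]_d => x ord0 i * \prod_(k < d) x ord0 k ^+ a k) =
    fun x => \prod_(k < d) x ord0 k ^+ b k.
  apply/funext => x; under [RHS]eq_bigr do rewrite bE exprD.
  rewrite big_split/= mulrC; congr (_ * _); rewrite (bigD1 i)//= eqxx expr1.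
  by rewrite big1 ?mulr1// => k /negbTE ->.
apply: span_monomial; under eq_bigr do rewrite bE.
have -> : (\sum_(k < d) (a k + (k == i)) = (\sum_(k < d) a k) + 1)%N.
  rewrite big_split/=; congr addn; rewrite (bigD1 i)//= eqxx big1// => k.
  by move/negbTE => ->.
by rewrite addn1.
Qed.

Let span_leq j p : span j p -> span j.+1 p.
Proof. by move=> [c c0 cE]; exists c => // a /c0/leqW. Qed.

(** Each monomial is expanded one affine factor at a time, by induction on the list of variables and
    then on the exponent; a factor raises the degree by at most one. This makes unisolvence
    invariant under [y |-> x0 + h *: y]. *)
Lemma poly_space_affine (p : 'rV[R]_d -> R) x0 h :
  poly_space m p -> poly_space m (fun y => p (x0 + h *: y)).
Proof.
have aux (r : seq 'I_d) (e : 'I_d -> nat) : (\sum_(i <- r) e i <= m)%N ->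
    span (\sum_(i <- r) e i)%N
      (fun y => \prod_(i <- r) (x0 + h *: y) ord0 i ^+ e i).
  elim: r => [_|i r IH].
    have -> : (fun y : 'rV[R]_d => \prod_(i <- [::]) (x0 + h *: y) ord0 i ^+ e i) =
        fun y => \prod_(i < d) y ord0 i ^+ (([ffun=> ord0] : {ffun 'I_d -> 'I_m.+1}) i).
      apply/funext => y; rewrite big_nil big1// => i _.
      by rewrite ffunE expr0.
    by rewrite big_nil; apply: span_monomial; rewrite big1// => i _; rewrite ffunE.
  have -> : (fun y : 'rV[R]_d => \prod_(j <- i :: r) (x0 + h *: y) ord0 j ^+ e j) =
      fun y => (x0 + h *: y) ord0 i ^+ e i *
        \prod_(j <- r) (x0 + h *: y) ord0 j ^+ e j.
    by apply/funext => y; rewrite big_cons.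
  rewrite big_cons.
  elim: (e i) => [|l IHl].
    rewrite add0n => /IH; congr (span _ _); apply/funext => y.
    by rewrite expr0 mul1r.
  rewrite addSn => lm; have sp := IHl (ltnW lm).
  have -> : (fun y : 'rV[R]_d => (x0 + h *: y) ord0 i ^+ l.+1 *
        \prod_(j <- r) (x0 + h *: y) ord0 j ^+ e j) =
      fun y => x0 ord0 i * ((x0 + h *: y) ord0 i ^+ l *
        \prod_(j <- r) (x0 + h *: y) ord0 j ^+ e j) +
      h * (y ord0 i * ((x0 + h *: y) ord0 i ^+ l *
        \prod_(j <- r) (x0 + h *: y) ord0 j ^+ e j)).
    apply/funext => y; rewrite exprS [X in X * _ * _ = _]mxE.
    by rewrite [(h *: y) _ _]mxE; ring.
  apply: spanD; first exact/spanZ/span_leq.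
  by apply/spanZ/span_mulX.
move=> [c cE].
have [b b0 bE] : span m (fun y => p (x0 + h *: y)).
  under eq_fun do rewrite cE big_enum_val.
  apply: span_sum => j; apply: spanZ.
  have /[!inE] jm := enum_valP j.
  have [b b0 bE] := aux (index_enum 'I_d) (fun i => exponent j i) jm.
  by exists b => // a /b0/leq_trans; apply.
exists b => x; rewrite bE (bigID (mem (multi_indices d m)))/=.
rewrite [X in _ + X]big1 ?addr0// => a; rewrite inE => aN.
have [->|/b0] := eqVneq (b a) 0; first by rewrite mul0r.
by move: aN => /negP.
Qed.
End polynomials.

(** * Calculus of C^k functions *)

Section Ck_calculus.
Variables (R : realType) (d : nat).
Implicit Types (U V : set 'rV[R]_d) (f g : 'rV[R]_d -> R) (k : nat).

Lemma Ck_continuous k U f x : Ck k U f -> U x -> {for x, continuous f}.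
Proof. by case: k => [|k] [+ _]; apply. Qed.

Lemma Ck_sub k U V f : U `<=` V -> Ck k V f -> Ck k U f.
Proof.
move=> UV; elim: k f => [|k IH] f [fc fD]; split=> //; try by move=> x /UV/fc.
by move=> i; have [? /IH] := fD i; split=> // x /UV; auto.
Qed.

Lemma CkW k U f : Ck k.+1 U f -> Ck k U f.
Proof.
elim: k f => [|k IH] f [fc fD]; split=> // i.
by have [fi /IH fDi] := fD i.
Qed.

(** On an open set, agreement on [U] is agreement near each point, so limits and derivatives carry
    over. *)
Lemma Ck_ext k U f g : open U -> (forall x, U x -> f x = g x) ->
  Ck k U f -> Ck k U g.
Proof.
move=> oU; elim: k f g => [|k IH] f g fg [fc fD].
- have nfg x : U x -> \forall y \near x, f y = g y.
    by move=> Ux; apply: filterS fg _; exact: open_nbhs_nbhs.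
  split=> // x Ux; change (g @ x --> g x); rewrite -fg//.
  by apply: cvg_trans (fc x Ux); exact: (@near_eq_cvg _ _ (nbhs x) _ _ _ (nfg x Ux)).
have nfg x : U x -> \forall y \near x, f y = g y.
  by move=> Ux; apply: filterS fg _; exact: open_nbhs_nbhs.
split=> [x Ux|i].
  change (g @ x --> g x); rewrite -fg//.
  by apply: cvg_trans (fc x Ux); exact: (@near_eq_cvg _ _ (nbhs x) _ _ _ (nfg x Ux)).
have [fi fDi] := fD i; split=> [x Ux|].
  by apply: near_eq_derivable (fi x Ux); exact: nfg.
by apply: IH fDi => x Ux; apply: near_eq_derive; exact: nfg.
Qed.

Lemma Ck_cst k U (c : R) : Ck k U (fun=> c).
Proof.
elim: k c => [|k IH] c; split=> //; try by move=> x _; exact: cst_continuous.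
move=> i; split=> [x _|]; first exact: derivable_cst.
have -> : (fun x => 'D_(basis_vec R i) (fun=> c : R) x) = fun=> 0 by
  apply/funext => x; exact: derive_cst.
exact: IH.
Qed.

Lemma CkD k U f g : open U -> Ck k U f -> Ck k U g ->
  Ck k U (fun x => f x + g x).
Proof.
move=> oU; elim: k f g => [|k IH] f g [fc fD] [gc gD].
  by split=> // x Ux; exact: (cvgD (fc x Ux) (gc x Ux)).
split=> [x Ux|i]; first exact: (cvgD (fc x Ux) (gc x Ux)).
have [fi fDi] := fD i; have [gi gDi] := gD i; split=> [x Ux|].
  exact: (derivableD (fi x Ux) (gi x Ux)).
apply: Ck_ext (IH _ _ fDi gDi) => // x Ux.
by rewrite (deriveD (fi x Ux) (gi x Ux)).
Qed.

Lemma CkM k U f g : open U -> Ck k U f -> Ck k U g ->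
  Ck k U (fun x => f x * g x).
Proof.
move=> oU; elim: k f g => [|k IH] f g fk gk.
  have [[fc _] [gc _]] := (fk, gk).
  by split=> // x Ux; exact: (cvgM (fc x Ux) (gc x Ux)).
have [[fc fD] [gc gD]] := (fk, gk).
split=> [x Ux|i]; first exact: (cvgM (fc x Ux) (gc x Ux)).
have [fi fDi] := fD i; have [gi gDi] := gD i; split=> [x Ux|].
  exact: (derivableM (fi x Ux) (gi x Ux)).
apply: Ck_ext (CkD oU (IH _ _ (CkW fk) gDi) (IH _ _ (CkW gk) fDi)) => // x Ux.
by rewrite (deriveM (fi x Ux) (gi x Ux)).
Qed.

(** The derivative of [1/f] is [- (1/f)^2 f'], and the factor [1/f] is already known to be of the
    lower class. *)
Lemma CkV k U f : open U -> (forall x, U x -> f x != 0) -> Ck k U f ->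
  Ck k U (fun x => (f x)^-1).
Proof.
move=> oU f0; elim: k => [|k IH] fk; have [fc fD] := fk.
  by split=> // x Ux; exact: (cvgV (f0 x Ux) (fc x Ux)).
split=> [x Ux|i]; first exact: (cvgV (f0 x Ux) (fc x Ux)).
have [fi fDi] := fD i; split=> [x Ux|].
  exact: (derivableV (f0 x Ux) (fi x Ux)).
have Vk := IH (CkW fk).
apply: Ck_ext (CkM oU (CkM oU (Ck_cst k U (-1)) (CkM oU Vk Vk)) fDi) => // x Ux.
by rewrite (deriveV (f0 x Ux) (fi x Ux)) mulN1r -exprVn expr2.
Qed.

Lemma Ck_coord k U j : Ck k U (fun x => x ord0 j).
Proof.
case: k => [|k]; split=> //; try by move=> x _; exact: coord_continuous.
move=> i.
have D x : is_derive x (basis_vec R i) (fun y : 'rV[R]_d => y ord0 j)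
    (basis_vec R i ord0 j).
  have di : derivable id x (basis_vec R i) by exact: derivable_id.
  have /derivable_mxP/(_ ord0 j) dj := di.
  apply: DeriveDef => //.
  have := derive_mx di.
  by rewrite derive_id => /rowP/(_ j); rewrite !mxE.
split=> [x _|]; first exact: ex_derive.
have -> : (fun x => 'D_(basis_vec R i) (fun y : 'rV[R]_d => y ord0 j) x) =
  fun=> basis_vec R i ord0 j by apply/funext => x; exact: derive_val.
exact: Ck_cst.
Qed.

(** The difference quotient along [c *: v] at [h] is [c] times the one along [v] at [h * c]. Only
    directional derivatives are available from [Ck], so this replaces the chain rule. The case
    [c = 0] is apart because [h * c] must stay away from 0. *)
Lemma is_derive_scale f x (v : 'rV[R]_d) (c : R) : derivable f x v ->
  is_derive x (c *: v) f (c * 'D_v f x).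
Proof.
move=> fv; have [->|c0] := eqVneq c 0.
  rewrite scale0r mul0r; apply: DeriveDef; first exact: derivable0.
  exact: derive0.
suff H : (fun h : R => h^-1 *: ((f \o shift x) (h *: (c *: v)) - f x)) @ 0^' -->
    c * 'D_v f x.
  apply: DeriveDef; first by apply/cvg_ex; exists (c * 'D_v f x).
  exact: cvg_lim H.
have -> : (fun h : R => h^-1 *: ((f \o shift x) (h *: (c *: v)) - f x)) =
    (fun h => c * (h^-1 *: ((f \o shift x) (h *: v) - f x))) \o (fun h => h * c).
  apply/funext => h /=; rewrite scalerA; have [->|h0] := eqVneq h 0.
    by rewrite !(mul0r, invr0, scale0r, mulr0).
  by rewrite /GRing.scale/= invfM -!mulrA [c * (h^-1 * _)]mulrCA mulVKf.
apply: cvg_comp (_ : (fun h => h * c) @ 0^' --> 0^') _.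
  move=> B [e /= e0 eB]; exists (e / `|c|) => /=.
    by rewrite divr_gt0 ?normr_gt0.
  move=> h /=; rewrite sub0r normrN ltr_pdivlMr ?normr_gt0// -normrM => hc h0.
  by apply: eB; rewrite /= ?sub0r ?normrN ?mulf_neq0.
by apply: cvgMl_tmp; exact: fv.
Qed.

(** Applied with [c] the inverse of the fill distance; [c = 0] is included, which covers a vanishing
    fill distance. *)
Lemma Ck_affine k f (c : R) y :
  Ck k setT f -> Ck k setT (fun x => f (c *: (x - y))).
Proof.
have ac : continuous (fun x : 'rV[R]_d => c *: (x - y)).
  have sc : continuous (fun x : 'rV[R]_d => x - y).
    move=> x; apply: (@cvgB _ _ _ (nbhs x) _ id (cst y)); first exact: cvg_id.
    exact: cvg_cst.
  move=> x; exact: (continuous_comp (sc x) (@scaler_continuous _ _ c (x - y))).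
elim: k f => [|k IH] f [fc fD].
  by split=> // x _; exact: (continuous_comp (ac x) (fc _ Logic.I)).
split=> [x _|i]; first by exact: (continuous_comp (ac x) (fc _ Logic.I)).
have [fi fDi] := fD i.
have D x : is_derive x (basis_vec R i) (fun x => f (c *: (x - y)))
    (c * 'D_(basis_vec R i) f (c *: (x - y))).
  have [] := is_derive_scale c (fi (c *: (x - y)) Logic.I).
  have E : (fun h : R => h^-1 *: (((fun x => f (c *: (x - y))) \o shift x)
       (h *: basis_vec R i) - f (c *: (x - y)))) =
     (fun h : R => h^-1 *: ((f \o shift (c *: (x - y)))
       (h *: (c *: basis_vec R i)) - f (c *: (x - y)))).
    apply/funext => h /=; congr (_ *: (f _ - _)).
    by rewrite -addrA scalerDr scalerA [h * c]mulrC -scalerA.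
  by move=> dx <-; apply: DeriveDef; rewrite /derivable /derive E.
split=> [x _|]; first exact: ex_derive.
apply: Ck_ext openT _ (CkM openT (Ck_cst k setT c) (IH _ fDi)) => x _.
by rewrite derive_val.
Qed.
End Ck_calculus.

(** * Moving least squares *)

Section mls_theory.
Variables (R : realType) (d m n : nat).
Implicit Types (theta f : 'rV[R]_d -> R) (X : 'I_n -> 'rV[R]_d) (xi : 'rV[R]_d).
Local Notation A := #|multi_indices d m|.

Definition design X : 'M[R]_(n, A) := \matrix_(i, j) monomials m (X i) ord0 j.

Lemma mul_designE X v i : (v *m (design X)^T) ord0 i = mpol v (X i).
Proof. by rewrite mxE; apply: eq_bigr => j _; rewrite !mxE. Qed.

Definition mls_gram theta X xi : 'M[R]_A :=
  gram (fun i => theta (xi - X i)) (design X).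

(** Right-hand side of the normal equations, whose matrix is [mls_gram]. *)
Definition mls_rhs theta X f xi : 'rV[R]_A :=
  \row_l \sum_i theta (xi - X i) * (f (X i) * monomials m (X i) ord0 l).

Lemma mls_gram_neq0 theta X xi : (forall x, 0 <= theta x) ->
  (\det (mls_gram theta X xi) != 0) <->
  (forall v : 'rV[R]_A, (forall i, theta (xi - X i) * mpol v (X i) = 0) -> v = 0).
Proof.
move=> theta0; rewrite /mls_gram det_gram_neq0//.
by split=> H v vX; apply: H => i; have := vX i; rewrite mul_designE.
Qed.

(** Pythagoras: the normal equations say that the residual of [u] is orthogonal to all polynomials
    for the weighted inner product, so the cross term vanishes. *)
Lemma mls_objectiveD theta X f xi u v :
  u *m mls_gram theta X xi = mls_rhs theta X f xi ->
  mls_objective theta X f xi (mpol (u + v)) =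
  mls_objective theta X f xi (mpol u) +
  \sum_i theta (xi - X i) * mpol v (X i) ^+ 2.
Proof.
move=> uG.
have cross : \sum_i theta (xi - X i) * ((mpol u (X i) - f (X i)) * mpol v (X i)) = 0.
  have /matrixP/(_ ord0) uGE := uG.
  transitivity (\sum_l ((u *m mls_gram theta X xi) ord0 l -
      mls_rhs theta X f xi ord0 l) * v ord0 l); last first.
    by rewrite big1// => l _; rewrite uGE subrr mul0r.
  rewrite /mls_gram; under [RHS]eq_bigr do
    rewrite mul_gramE mxE -sumrB mulr_suml.
  rewrite exchange_big; apply: eq_bigr => i _ /=.
  rewrite {2}/mpol !mulr_sumr; apply: eq_bigr => l _.
  by rewrite mul_designE [design X i l]mxE; ring.
have cross2 := congr1 (fun z => 2 * z) cross; rewrite mulr0 mulr_sumr in cross2.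
rewrite /mls_objective -[RHS]addr0 -[X in _ = _ + X]cross2 -!big_split/=.
by apply: eq_bigr => i _; rewrite mpolD; ring.
Qed.

Lemma mls_argmin_mpol theta X f xi : (forall x, 0 <= theta x) ->
  \det (mls_gram theta X xi) != 0 ->
  mls_argmin m theta X f xi =
  [set mpol (mls_rhs theta X f xi *m invmx (mls_gram theta X xi))].
Proof.
move=> theta0 detN0; set u := _ *m _.
have uG : u *m mls_gram theta X xi = mls_rhs theta X f xi.
  by rewrite mulmxKV// unitmxE unitfE.
have quad_ge0 (v : 'rV[R]_A) i : true -> 0 <= theta (xi - X i) * mpol v (X i) ^+ 2.
  by move=> _; rewrite mulr_ge0// sqr_ge0.
apply/seteqP; split=> [p [/poly_spaceP[w ->] wmin]|p ->].
  suff w0 : w - u = 0 by rewrite -[w](subrK u) w0 add0r.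
  apply: (mls_gram_neq0 X xi theta0).1 => // i.
  have /wmin : poly_space m (mpol u) by apply/poly_spaceP; exists u.
  rewrite -[w in leLHS](subrK u) addrC (mls_objectiveD _ uG) gerDl => le0.
  have /eqP : \sum_i theta (xi - X i) * mpol (w - u) (X i) ^+ 2 = 0.
    by apply/eqP; rewrite eq_le le0 sumr_ge0// => j; exact: quad_ge0.
  rewrite psumr_eq0; last exact: quad_ge0.
  move=> /allP/(_ i (mem_index_enum i)) /=.
  by rewrite mulf_eq0 expf_eq0/= -mulf_eq0 => /eqP.
split=> [|_ /poly_spaceP[w ->]]; first by apply/poly_spaceP; exists u.
rewrite -[w](subrK u) addrC (mls_objectiveD _ uG) lerDl sumr_ge0// => j.
exact: quad_ge0.
Qed.

(** If [mpol v] vanishes at every site of nonzero weight, adding [v] to a minimizer leaves the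
    objective unchanged; uniqueness forces [v = 0]. *)
Lemma mls_unique_gram_neq0 theta X f xi : (forall x, 0 <= theta x) ->
  (exists! p, mls_argmin m theta X f xi p) -> \det (mls_gram theta X xi) != 0.
Proof.
move=> theta0 [_ [[/poly_spaceP[u ->] umin] uuniq]].
apply/mls_gram_neq0 => // v vX.
suff /uuniq/mpol_inj : mls_argmin m theta X f xi (mpol (u + v)).
  by rewrite -[LHS]addr0 => /addrI.
split=> [|q /umin]; first by apply/poly_spaceP; exists (u + v).
congr (_ <= _); apply: eq_bigr => i _; rewrite mpolD.
have /eqP := vX i; rewrite mulf_eq0 => /orP[] /eqP ->; first by rewrite !mulr0.
by rewrite addr0.
Qed.

Lemma Ck_mls_gram k U theta X : open U -> Ck k setT theta ->
  forall i j, Ck k U (fun xi => mls_gram theta X xi i j).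
Proof.
move=> oU thetak i j.
under eq_fun do rewrite mxE.
apply: (@fun_ring_sum _ _ (Ck k U) (Ck_cst k U)) => [f g|l]; first exact: CkD.
apply: CkM => //; last exact: Ck_cst.
under eq_fun do rewrite -[X in theta X]scale1r.
exact: Ck_sub (Ck_affine _ _ thetak).
Qed.

Lemma Ck_det_mls_gram k U theta X : open U -> Ck k setT theta ->
  Ck k U (fun xi => \det (mls_gram theta X xi)).
Proof.
move=> oU thetak; apply: (@fun_ring_det _ _ (Ck k U) (Ck_cst k U)).
- by move=> p q; exact: CkD.
- by move=> p q; exact: CkM.
- exact: Ck_mls_gram.
Qed.

Lemma mls_smooth_onP k theta X f K : (forall x, 0 <= theta x) ->
  Ck k setT theta ->
  mls_smooth_on m theta X f k K <->
  (forall xi, K xi -> \det (mls_gram theta X xi) != 0).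
Proof.
move=> theta0 thetak; split=> [[uniqK _] xi /uniqK|detN0].
  exact: mls_unique_gram_neq0.
split=> [xi Kxi|].
  by rewrite mls_argmin_mpol ?detN0//; eexists; split=> // p ->.
pose U := [set xi | \det (mls_gram theta X xi) != 0].
pose G xi := mls_gram theta X xi.
have oU : open U.
  rewrite (_ : U = (fun xi => \det (G xi)) @^-1` [set y | y != 0])//.
  apply: open_comp; last exact: open_neq.
  by move=> xi _; apply: Ck_continuous (Ck_det_mls_gram X openT thetak) _.
(* Cramer's rule: the coefficients are written with the adjugate and the inverse determinant, hence
   as rational expressions in C^k functions, on the open set [U] where the determinant does not
   vanish. *)
exists U, (fun xi => mpol (mls_rhs theta X f xi *m
   ((\det (G xi))^-1 *: \adj (G xi))) xi); split=> //.
- have wk i : Ck k U (fun xi => theta (xi - X i)).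
    under eq_fun do rewrite -[X in theta X]scale1r.
    exact: Ck_sub (Ck_affine _ _ thetak).
  have addk (p q : 'rV[R]_d -> R) : Ck k U p -> Ck k U q -> Ck k U (fun x => p x + q x).
    exact: CkD.
  have mulk (p q : 'rV[R]_d -> R) : Ck k U p -> Ck k U q -> Ck k U (fun x => p x * q x).
    exact: CkM.
  apply: (@fun_ring_sum _ _ (Ck k U) (Ck_cst k U) addk) => j; apply/mulk.
    under eq_fun do rewrite mxE.
    apply: (@fun_ring_sum _ _ (Ck k U) (Ck_cst k U) addk) => l; apply/mulk.
      under eq_fun do rewrite mxE.
      apply: (@fun_ring_sum _ _ (Ck k U) (Ck_cst k U) addk) => i.
      by apply/mulk => //; exact: Ck_cst.
    under eq_fun do rewrite mxE.
    apply/mulk; first by apply: CkV => //; exact: Ck_det_mls_gram.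
    apply: (@fun_ring_adj _ _ (Ck k U) (Ck_cst k U) addk mulk); exact: Ck_mls_gram.
  under eq_fun do rewrite mxE.
  apply: (@fun_ring_prod _ _ (Ck k U) (Ck_cst k U) mulk) => i.
  rewrite /exponent; elim: (nat_of_ord _) => [|e IH].
    by under eq_fun do rewrite expr0; exact: Ck_cst.
  by under eq_fun do rewrite exprS; apply/mulk => //; exact: Ck_coord.
- move=> xi /detN0 dxi; rewrite /mls mls_argmin_mpol//.
  have -> : xget (fun=> 0) [set mpol (mls_rhs theta X f xi *m invmx (G xi))] =
    mpol (mls_rhs theta X f xi *m invmx (G xi)).
    by apply: xget_unique => // p ->.
  by rewrite /invmx unitmxE unitfE dxi.
Qed.
End mls_theory.

(** * Euclidean norm and fill distance *)

Section euclidean_norm.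
Variables (R : realType) (d : nat).
Implicit Types x y : 'rV[R]_d.

Lemma edotC x y : edot x y = edot y x.
Proof. by apply: eq_bigr => i _; rewrite mulrC. Qed.

Lemma edotDl x y z : edot (x + y) z = edot x z + edot y z.
Proof. by rewrite -big_split; apply: eq_bigr => i _; rewrite mxE mulrDl. Qed.

Lemma edotZl (c : R) x y : edot (c *: x) y = c * edot x y.
Proof. by rewrite mulr_sumr; apply: eq_bigr => i _; rewrite mxE mulrA. Qed.

Lemma edot_ge0 x : 0 <= edot x x.
Proof. by apply: sumr_ge0 => i _; rewrite -expr2 sqr_ge0. Qed.

Lemma enorm_ge0 x : 0 <= enorm x. Proof. exact: sqrtr_ge0. Qed.

Lemma sqr_enorm x : enorm x ^+ 2 = edot x x.
Proof. by rewrite sqr_sqrtr// edot_ge0. Qed.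

Lemma enormZ (c : R) x : enorm (c *: x) = `|c| * enorm x.
Proof.
by rewrite /enorm edotZl edotC edotZl mulrA -expr2 sqrtrM ?sqr_ge0// sqrtr_sqr.
Qed.

Lemma enorm0 : enorm (0 : 'rV[R]_d) = 0.
Proof. by rewrite -(scale0r 0) enormZ normr0 mul0r. Qed.

Lemma eball_center x r : 0 <= r -> eball x r x.
Proof. by rewrite /eball/= subrr enorm0. Qed.

Lemma enormN x : enorm (- x) = enorm x.
Proof. by rewrite -scaleN1r enormZ normrN1 mul1r. Qed.

Lemma enormB x y : enorm (x - y) = enorm (y - x).
Proof. by rewrite -enormN opprB. Qed.

Lemma ler_coord_enorm x i : `|x ord0 i| <= enorm x.
Proof.
rewrite -sqrtr_sqr ler_sqrt ?edot_ge0// /edot (bigD1 i)//= -expr2 lerDl.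
by apply: sumr_ge0 => j _; rewrite -expr2 sqr_ge0.
Qed.

Lemma enorm0_eq0 x : enorm x = 0 -> x = 0.
Proof.
move=> x0; apply/rowP => i; rewrite mxE; apply/eqP.
by rewrite -normr_le0 -x0 ler_coord_enorm.
Qed.

(** Cauchy-Schwarz, from the squared length of [enorm y *: x - enorm x *: y]. *)
Lemma edot_le x y : edot x y <= enorm x * enorm y.
Proof.
have [x0|x0] := eqVneq (enorm x) 0.
  rewrite x0 mul0r (enorm0_eq0 x0) /edot big1// => i _.
  by rewrite mxE mul0r.
have [y0|y0] := eqVneq (enorm y) 0.
  rewrite y0 mulr0 (enorm0_eq0 y0) /edot big1// => i _.
  by rewrite mxE mulr0.
have := edot_ge0 (enorm y *: x - enorm x *: y).
have -> : edot (enorm y *: x - enorm x *: y) (enorm y *: x - enorm x *: y) =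
    2 * (enorm x * enorm y) * (enorm x * enorm y - edot x y).
  rewrite -scaleNr edotDl !edotZl ![edot _ (_ + _)]edotC !edotDl !edotZl.
  by rewrite -!sqr_enorm [edot y x]edotC; ring.
have xy : 0 < 2 * (enorm x * enorm y).
  by rewrite !mulr_gt0// lt0r ?x0 ?y0 enorm_ge0.
by rewrite pmulr_rge0// subr_ge0.
Qed.

Lemma ler_enormD x y : enorm (x + y) <= enorm x + enorm y.
Proof.
rewrite -(@ler_pXn2r _ 2)// ?nnegrE ?addr_ge0 ?enorm_ge0// sqr_enorm.
rewrite edotDl ![edot _ (x + y)]edotC !edotDl sqrrD !sqr_enorm [edot y x]edotC.
have := edot_le x y; lra.
Qed.

Lemma edot_continuous y : continuous (fun x => edot x y).
Proof.
move=> x; rewrite /continuous_at.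
apply: (@fun_ring_sum _ _ (fun f : 'rV[R]_d -> R => {for x, continuous f}))
  => [c|f g fc gc|i]; first exact: cst_continuous.
  exact: (cvgD fc gc).
by apply: (cvgM (@coord_continuous _ _ _ ord0 i x)); exact: cst_continuous.
Qed.

Lemma enorm_continuous : continuous (@enorm R d).
Proof.
move=> x.
apply: (@continuous_comp _ _ _ (fun x => edot x x) Num.sqrt) => /=.
  apply: (@fun_ring_sum _ _ (fun f : 'rV[R]_d -> R => {for x, continuous f}))
    => [c|f g fc gc|i]; first exact: cst_continuous.
    exact: (cvgD fc gc).
  exact: (cvgM (@coord_continuous _ _ _ ord0 i x) (@coord_continuous _ _ _ ord0 i x)).
exact: sqrt_continuous.
Qed.

Lemma continuous_subr y : continuous (fun x : 'rV[R]_d => x - y).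
Proof.
move=> x; apply: (@cvgB _ _ _ (nbhs x) _ id (cst y)); first exact: cvg_id.
exact: cvg_cst.
Qed.

Lemma enormB_continuous y : continuous (fun x => enorm (x - y)).
Proof.
move=> x; exact: (continuous_comp (@continuous_subr y x) (@enorm_continuous _)).
Qed.

Lemma eball0_compact : compact (eball (0 : 'rV[R]_d) 1).
Proof.
have bc := @rV_compact R d (fun=> `[-1, 1]%classic) (fun=> @segment_compact _ _ _).
apply: (subclosed_compact _ bc) => [|x /=].
  rewrite (_ : eball _ _ = (fun x => enorm (x - 0)) @^-1` [set t | t <= 1])//.
  have /continuous_closedP := @enormB_continuous (0 : 'rV[R]_d).
  by apply; exact: closed_le.
rewrite /eball/= subr0 => x1 i; rewrite in_itv/= -ler_norml.
exact: le_trans (ler_coord_enorm x i) x1.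
Qed.

(* Rational balls are indexed by N; every one that meets [S] contributes one of
   its points. *)
Lemma countable_dense (S : set 'rV[R]_d) : S !=set0 ->
  exists y : nat -> 'rV[R]_d, (forall k, S (y k)) /\
    forall x e, S x -> 0 < e -> exists k, ball x e (y k).
Proof.
move=> [s Ss].
pose c (q : 'rV[rat]_d) : 'rV[R]_d := map_mx ratr q.
pose Q (k : nat) z := S z /\ forall q r, unpickle k = Some (q, r) ->
  ball (c q) r.+1%:R^-1 z.
pose y k := xget s (Q k); exists y; split=> [k|x e Sx e0].
  by rewrite /y; case: xgetP => // z _ [].
have [r re] : exists r : nat, r.+1%:R^-1 < e / 2.
  have /cvgrPdist_lt/(_ (e / 2)) [|r _ /(_ r (leqnn r))] := @cvg_harmonic R.
    by rewrite divr_gt0.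
  by rewrite sub0r normrN ger0_norm ?invr_ge0// => re; exists r.
have /choice[q qP] i : exists q : rat, `|ratr q - x ord0 i| < r.+1%:R^-1 :> R.
  have /rat_in_itvoo[q] : x ord0 i - r.+1%:R^-1 < x ord0 i + r.+1%:R^-1.
    by rewrite ltrD2l (@lt_trans _ _ 0)// ?oppr_lt0 invr_gt0.
  by rewrite in_itv/= => qi; exists q; rewrite ltr_distl.
exists (pickle (\row_i q i : 'rV[rat]_d, r)).
have cx : ball (c (\row_i q i)) r.+1%:R^-1 x.
  by split=> [|i j]; rewrite ?invr_gt0// ord1 !mxE; exact: qP.
have Qx : Q (pickle (\row_i q i : 'rV[rat]_d, r)) x.
  by split=> // q' r'; rewrite pickleK => -[<- <-].
have [_ /(_ _ _ (pickleK _)) cy] := xgetI s Qx.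
rewrite [e]splitr; apply: ball_triangle (_ : ball x _ (c (\row_i q i))) _.
  by apply/ball_sym/(le_ball _ cx)/ltW.
exact/(le_ball _ cy)/ltW.
Qed.

Lemma dense_closed (S F : set 'rV[R]_d) (y : nat -> 'rV[R]_d) :
  (forall x e, S x -> 0 < e -> exists k, ball x e (y k)) -> closed F ->
  (forall k, F (y k)) -> S `<=` F.
Proof.
move=> yS Fc Fy x Sx; apply: Fc => B /nbhs_ballP[e /= e0 eB].
by have [k /eB By] := yS x e Sx e0; exists (y k).
Qed.
End euclidean_norm.

Section fill_distance_theory.
Variables (R : realType) (d : nat) (Omega : set 'rV[R]_d).
Hypotheses (Omega_compact : compact Omega) (Omega0 : Omega !=set0).

Lemma inf_range_le n (g : 'I_n.+1 -> R) t :
  inf (range g) <= t <-> exists i, g i <= t.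
Proof.
have lb : has_lbound (range g).
  exists (\big[Order.min/g ord0]_i g i) => _ [i _ <-].
  exact: bigmin_le_cond.
split=> [|[i]]; last by apply: le_trans; apply: ge_inf => //; exists i.
have [i _ imin] := arg_minP g (isT : xpredT (ord0 : 'I_n.+1)).
move=> gt; exists i; apply: le_trans gt; apply: lb_le_inf.
  by exists (g ord0), ord0.
by move=> _ [j _ <-]; exact: imin.
Qed.

(** Turns a bound on the fill distance into a covering of [Omega] by balls around the sites.
    Compactness makes the distances bounded, so that [sup] is a true supremum. *)
Lemma fill_distance_le n (X : 'I_n.+1 -> 'rV[R]_d) t :
  fill_distance Omega X <= t <->
  (forall x, Omega x -> exists i, enorm (x - X i) <= t).
Proof.
set S := [set inf (range (fun i => enorm (x - X i))) | x in Omega].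
have ubS : has_ubound S.
  have [c _ cmax] := compact_EVT_max Omega0 Omega_compact
    (continuous_subspaceT (@enormB_continuous _ _ (X ord0))).
  exists (enorm (c - X ord0)) => _ [x Ox <-].
  by apply/inf_range_le; exists ord0; apply: cmax; rewrite inE.
split=> [ht x Ox|H].
  apply/inf_range_le/(le_trans _ ht)/ub_le_sup => //.
  by exists x.
apply: ge_sup => [|_ [x /H Hx <-]]; last exact/inf_range_le.
by have [x Ox] := Omega0; exists (inf (range (fun i => enorm (x - X i)))), x.
Qed.

Lemma fill_distance_ge0 n (X : 'I_n.+1 -> 'rV[R]_d) : 0 <= fill_distance Omega X.
Proof.
have [x Ox] := Omega0; have := lexx (fill_distance Omega X).
by move=> /fill_distance_le /(_ x Ox) [i]; apply: le_trans; exact: enorm_ge0.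
Qed.
End fill_distance_theory.

(** * Measurability *)

Section measurable_vectors.
Variables (R : realType) (d : nat) (dT : measure_display) (T : measurableType dT).

Lemma open_measurable_rV (U : set 'rV[R]_d) : open U -> measurable U.
Proof. by move=> oU; exact: sub_sigma_algebra. Qed.

Lemma closed_measurable_rV (F : set 'rV[R]_d) : closed F -> measurable F.
Proof.
move=> cF; rewrite -[F]setCK; apply: measurableC; apply: open_measurable_rV.
exact: closed_openC.
Qed.

Lemma measurable_continuous_comp (f : 'rV[R]_d -> R) (g : T -> 'rV[R]_d) :
  continuous f -> measurable_fun setT g -> measurable_fun setT (fun w => f (g w)).
Proof.
move=> /continuousP fc mg.
apply: (measurability _ (measurable_realfun.RGenOpens.measurableE R)).
move=> _ [_ [a [b ->] <-]]; rewrite setTI.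
have /open_measurable_rV mU : open (f @^-1` `]a, b[) by exact/fc/interval_open.
by have := mg measurableT _ mU; rewrite setTI.
Qed.

Lemma measurable_coord (g : T -> 'rV[R]_d) i :
  measurable_fun setT g -> measurable_fun setT (fun w => g w ord0 i).
Proof.
move=> mg.
exact: (measurable_continuous_comp (@coord_continuous _ _ _ ord0 i) mg). Qed.

Lemma measurable_rV (g : T -> 'rV[R]_d) :
  (forall i, measurable_fun setT (fun w => g w ord0 i)) -> measurable_fun setT g.
Proof.
move=> mg.
have -> : g = (@rV_of_tuple R d) \o (fun w => [tuple g w ord0 i | i < d]).
  by apply/funext => w; apply/rowP => i; rewrite mxE tnth_mktuple.
apply: measurableT_comp; first exact: measurable_rV_of_tuple.
apply/measurable_fun_tnthP => i; have := mg i; congr measurable_fun.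
by apply/funext => w /=; rewrite tnth_mktuple.
Qed.

(** On nonnegative reals inversion is the power [-1], including the value 0 at 0. *)
Lemma measurable_inv_ge0 (g : T -> R) : (forall w, 0 <= g w) ->
  measurable_fun setT g -> measurable_fun setT (fun w => (g w)^-1).
Proof.
move=> g0 mg; under eq_fun do rewrite -powR_inv1//.
exact: (measurableT_comp (measurable_powR (-1)) mg).
Qed.

Lemma measurable_ler_set (f g : T -> R) : measurable_fun setT f ->
  measurable_fun setT g -> measurable [set w | f w <= g w].
Proof.
by move=> mf mg; rewrite -[X in measurable X]setTI; exact: measurable_fun_le.
Qed.
Lemma measurable_card (I : finType) (B : I -> set T) :
  (forall i, measurable (B i)) ->
  measurable_fun setT (fun w => #|finset (fun i => w \in B i)|%:R : R).
Proof.
move=> mB.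
have -> : (fun w => #|finset (fun i => w \in B i)|%:R : R) =
    fun w => \sum_i \1_(B i) w.
  apply/funext => w; rewrite -sum1_card natr_sum big_mkcond/=.
  by apply: eq_bigr => i _; rewrite inE indicE; case: (_ \in _).
by apply: measurable_sum => i; exact: measurable_indic.
Qed.
End measurable_vectors.

Section measurable_sample.
Variables (R : realType) (d : nat) (dT : measure_display) (T : measurableType dT)
  (n : nat) (X : 'I_n.+1 -> T -> 'rV[R]_d) (Omega : set 'rV[R]_d).
Hypotheses (mX : forall i, measurable_fun setT (X i))
  (Omega_compact : compact Omega) (Omega0 : Omega !=set0).
Local Notation h w := (fill_distance Omega (X^~ w)).

(** A finite union of closed balls around the sites contains [Omega] as soon as it contains a dense
    sequence of [Omega], so [h <= t] is a countable condition. *)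
Lemma measurable_fill_distance : measurable_fun setT (fun w => h w).
Proof.
have [y [Oy yO]] := countable_dense Omega0.
apply: (measurability _ (measurable_realfun.RGenOInfty.measurableE R)).
move=> _ [_ [t ->] <-]; rewrite setTI -[X in measurable X]setCK.
apply: measurableC.
have -> : ~` ((fun w => h w) @^-1` `]t, +oo[) =
    \bigcap_k \bigcup_i [set w | enorm (X i w - y k) <= t].
  apply/seteqP; split=> w /=; rewrite in_itv/= andbT.
    move=> /negP; rewrite -leNgt => ht k _.
    have [i] := (fill_distance_le Omega_compact Omega0 _ _).1 ht _ (Oy k).
    by exists i => //=; rewrite enormB.
  move=> H; apply/negP; rewrite -leNgt; apply/fill_distance_le => // x Ox.
  suff [i _] : (\bigcup_i [set z | enorm (z - X i w) <= t]) x by exists i.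
  apply: (dense_closed yO) Ox.
    apply: closed_bigcup => [|i _]; first exact: finite_finset.
    have /continuous_closedP cE := @enormB_continuous R d (X i w).
    by apply: (cE [set r | r <= t]); exact: closed_le.
  by move=> k; have [i _ iy] := H k Logic.I; exists i => //=; rewrite enormB.
apply: bigcapT_measurable => k.
apply: countable_bigcupT_measurable => [|i]; first exact: countableP.
apply: measurable_ler_set => //.
exact: (measurable_continuous_comp (@enormB_continuous _ _ _) (mX i)).
Qed.

Lemma measurable_site (x0 : 'rV[R]_d) s i :
  measurable [set w | enorm (X i w - x0) <= s * h w].
Proof.
apply: measurable_ler_set.
  exact: (measurable_continuous_comp (@enormB_continuous _ _ _) (mX i)).
by apply: measurable_funM => //; exact: measurable_fill_distance.
Qed.

Lemma measurable_card_sites (x0 : 'rV[R]_d) s :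
  measurable_fun setT (fun w =>
    #|sites_in (X^~ w) (eball x0 (s * h w))|%:R : R).
Proof.
pose B i := [set w | enorm (X i w - x0) <= s * h w].
have SE w : sites_in (X^~ w) (eball x0 (s * h w)) = finset (fun i => w \in B i).
  apply/finset.setP => i; rewrite [LHS]inE [RHS]inE.
  by apply/idP/idP => /set_mem Xw; exact/mem_set.
under eq_fun do rewrite SE.
by apply: measurable_card => i; exact: measurable_site.
Qed.

(** A nonvanishing continuous function on a compact set is bounded away from 0, and such a bound can
    be tested on a dense sequence. This replaces an uncountable intersection of events by countable
    operations. *)
Lemma continuous_nonvanishing_bound (K : set 'rV[R]_d) (phi : 'rV[R]_d -> R)
    (y : nat -> 'rV[R]_d) : compact K -> (forall k, K (y k)) ->
  (forall x e, K x -> 0 < e -> exists k, ball x e (y k)) -> continuous phi ->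
  (forall x, K x -> phi x != 0) <->
  exists l : nat, forall k, l.+1%:R^-1 <= `|phi (y k)|.
Proof.
move=> Kc Ky yK phic.
have nphic : continuous (fun x => `|phi x|).
  by move=> x; apply: continuous_comp; [exact: phic|exact: norm_continuous].
split=> [phi0|[l lP] x Kx].
  have K0 : K !=set0 by exists (y 0%N).
  have [c /[!inE] Kx cmin] := compact_EVT_min K0 Kc (continuous_subspaceT nphic).
  have c0 : 0 < `|phi c| by rewrite normr_gt0 phi0.
  have [l lc] : exists l : nat, l.+1%:R^-1 < `|phi c|.
    have /cvgrPdist_lt/(_ _ c0) [l _ /(_ l (leqnn l))] := @cvg_harmonic R.
    by rewrite sub0r normrN ger0_norm ?invr_ge0// => lc; exists l.
  by exists l => k; rewrite (le_trans (ltW lc))// cmin// inE.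
rewrite -normr_gt0 (lt_le_trans (_ : 0 < l.+1%:R^-1)) ?invr_gt0//.
apply: (dense_closed yK (F := [set x | l.+1%:R^-1 <= `|phi x|])) => //.
move/continuous_closedP: nphic => /(_ [set t | l.+1%:R^-1 <= t]).
by apply; exact: closed_ge.
Qed.

Lemma measurable_nonvanishing_gram m (Phi : 'rV[R]_d -> R) (x0 : 'rV[R]_d) a :
  Ck 0 setT Phi -> 0 <= a ->
  measurable [set w | forall xi, eball x0 (a * h w) xi ->
    \det (mls_gram m (scaled_weight Phi (h w)) (X^~ w) xi) != 0].
Proof.
move=> Phi0 a0.
have hge0 w : 0 <= h w by exact: fill_distance_ge0.
(* The ball has a random radius; it is parametrized by the fixed unit ball, so that one dense
   sequence serves every [w]. *)
pose g w u := \det (mls_gram m (scaled_weight Phi (h w)) (X^~ w)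
  (x0 + (a * h w) *: u)).
have B0 : eball (0 : 'rV[R]_d) 1 !=set0.
  by exists 0; apply: eball_center; exact: ler01.
have [y [By yB]] := countable_dense B0.
have gc w : continuous (g w).
  have sc : Ck 0 setT (scaled_weight Phi (h w)).
    have := Ck_affine (h w)^-1 0 Phi0; congr (Ck _ _ _).
    by apply/funext => x; rewrite subr0.
  move=> u.
  have dc : continuous
      (fun xi => \det (mls_gram m (scaled_weight Phi (h w)) (X^~ w) xi)).
    move=> xi.
    apply: (@Ck_continuous _ _ 0 setT) => //.
    by apply: Ck_det_mls_gram sc; exact: openT.
  have ac : continuous (fun v : 'rV[R]_d => x0 + (a * h w) *: v).
    move=> v; apply: (@cvgD _ _ _ (nbhs v) _ (cst x0) (fun v => (a * h w) *: v)).
      exact: cvg_cst.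
    exact: scaler_continuous.
  exact: (continuous_comp (ac u) (dc (x0 + (a * h w) *: u))).
have -> : [set w | forall xi, eball x0 (a * h w) xi ->
      \det (mls_gram m (scaled_weight Phi (h w)) (X^~ w) xi) != 0] =
    \bigcup_l \bigcap_k [set w | l.+1%:R^-1 <= `|g w (y k)| ].
  apply/seteqP; split=> w /=.
    move=> H; have /(continuous_nonvanishing_bound
      (@eball0_compact R d) By yB (gc w))[l lP] :
        forall u, eball 0 1 u -> g w u != 0.
      move=> u; rewrite /eball/= subr0 => u1; apply: H; rewrite /eball/= addrC addKr.
      by rewrite enormZ ger0_norm ?mulr_ge0// ler_piMr// mulr_ge0.
    by exists l => // k _; exact: lP.
  move=> [l _ lP] xi.
  have H := (continuous_nonvanishing_bound (@eball0_compact R d) By yB (gc w)).2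
    (ex_intro _ l (fun k => lP k Logic.I)).
  rewrite /eball/= => xix0.
  (* A ball of radius 0 is the point [x0], the image of [u = 0]; rescaling is possible only for
     positive radius. *)
  have [ah0|ah0] := eqVneq (a * h w) 0.
    move: xix0; rewrite ah0 => xix0.
    have /enorm0_eq0/eqP : enorm (xi - x0) = 0.
      by apply/eqP; rewrite eq_le xix0 enorm_ge0.
    rewrite subr_eq0 => /eqP ->; have := H 0.
    by rewrite /g scaler0 addr0; apply; apply: eball_center; exact: ler01.
  have := H ((a * h w)^-1 *: (xi - x0)).
  rewrite /g scalerA divff// scale1r [x0 + _]addrC subrK; apply.
  rewrite /eball/= subr0 enormZ ger0_norm ?invr_ge0 ?mulr_ge0//.
  by rewrite ler_pdivrMl ?mulr1// lt0r ah0 mulr_ge0.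
apply: bigcupT_measurable => l; apply: bigcapT_measurable => k.
apply: measurable_ler_set => //; apply: measurableT_comp => //.
have mh := measurable_fill_distance.
have mD (p q : T -> R) : measurable_fun setT p -> measurable_fun setT q ->
  measurable_fun setT (fun w => p w + q w) by exact: measurable_funD.
have mM (p q : T -> R) : measurable_fun setT p -> measurable_fun setT q ->
  measurable_fun setT (fun w => p w * q w) by exact: measurable_funM.
have mC (c : R) : measurable_fun setT (fun _ : T => c) by exact: measurable_cst.
have mmon i j : measurable_fun setT (fun w => monomials m (X i w) ord0 j).
  under eq_fun do rewrite mxE.
  apply: (@fun_ring_prod R T (fun p => measurable_fun setT p) mC mM _ _ _
    (fun c w => X i w ord0 c ^+ exponent j c)) => c.
  elim: (nat_of_ord _) => [|e IH].
    by under eq_fun do rewrite expr0; exact: mC.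
  by under eq_fun do rewrite exprS; apply/mM => //; exact: measurable_coord.
pose xi w : 'rV[R]_d := x0 + (a * h w) *: y k.
apply: (@fun_ring_det R T (fun p => measurable_fun setT p) mC mD mM _
  (fun w => mls_gram m (scaled_weight Phi (h w)) (X^~ w) (xi w))) => i j.
under eq_fun do rewrite mxE.
apply: (@fun_ring_sum R T (fun p => measurable_fun setT p) mC mD _ _ _
  (fun l w => scaled_weight Phi (h w) (xi w - X l w) *
    (design m (X^~ w) l i * design m (X^~ w) l j))) => l'.
apply/mM; last first.
  by apply/mM; under eq_fun do rewrite mxE; exact: mmon.
have Phic : continuous Phi.
  by move=> x; exact: (Ck_continuous Phi0 (Logic.I : [set: _] x)).
apply: (measurable_continuous_comp Phic).
apply: measurable_rV => c.
under eq_fun do rewrite !mxE.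
apply: (mM (fun w => (h w)^-1)
  (fun w => x0 ord0 c + a * h w * y k ord0 c - X l' w ord0 c)).
  exact: measurable_inv_ge0.
apply: (mD _ (fun w => - X l' w ord0 c)).
  by apply/mD => //; apply/mM => //; apply/mM.
by apply: measurable_funN; exact: measurable_coord.
Qed.
End measurable_sample.

(** * Binomial tails and densities *)

Lemma measure_sub_sum (R : realType) (dT : measure_display) (T : measurableType dT)
    (m : measure T R) (I : finType) (A : set T) (F : I -> set T) :
  measurable A -> (forall i, measurable (F i)) -> A `<=` \bigcup_i F i ->
  (m A <= \sum_i m (F i))%E.
Proof.
move=> mA mF AF.
have -> : A = \big[setU/set0]_(i <- enum I) (A `&` F i).
  rewrite -big_distrr/= -bigcup_seq setIidl// => x /AF[i _ Fix].
  by exists i => //=; rewrite mem_enum.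
rewrite -big_enum/=; elim: (enum I) => [|i r IH].
  by rewrite !big_nil measure0.
rewrite !big_cons; apply: le_trans (measureU2 _ _ _) _.
- exact: measurableI.
- by apply: bigsetU_measurable => j _; exact: measurableI.
- apply: leeD IH; apply: le_measure; rewrite ?inE//; first exact: measurableI.
Qed.

Section binomial_tail.
Variables (R : realType) (d n : nat) (dT : measure_display) (T : measurableType dT)
  (P : probability T R) (X : 'I_n -> {RV P >-> 'rV[R]_d})
  (mu : probability 'rV[R]_d R).
Hypothesis X_iid : iid_sample X mu.

Lemma measurable_RV_preimage i (B : set 'rV[R]_d) :
  measurable B -> measurable (X i @^-1` B).
Proof. by move=> mB; rewrite -[X in measurable X]setTI; exact: measurable_funPT. Qed.

Lemma measurable_pattern (B : 'I_n -> set 'rV[R]_d) :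
  (forall i, measurable (B i)) -> measurable [set w | forall i, B i (X i w)].
Proof.
move=> mB; rewrite (_ : mkset _ = \bigcap_(i in setT) (X i @^-1` B i)).
  apply: fin_bigcap_measurable => // i _.
  exact: measurable_RV_preimage.
by apply/seteqP; split => [w h i _|w h i]; [exact: h|exact: (h i)].
Qed.

Lemma measurable_sites_in (K : set 'rV[R]_d) : measurable K ->
  measurable_fun setT (fun w => #|sites_in (sample X w) K|%:R : R).
Proof.
by move=> mK; exact: (measurable_card (fun i => measurable_RV_preimage i mK)).
Qed.

(* Markov's inequality for [t ^+ N], where [N] counts the sites in [K]. *)
Lemma sites_in_tail (K : set 'rV[R]_d) (t tau : R) :
  measurable K -> 0 <= t -> 0 < tau ->
  (P [set w | (tau <= t ^+ #|sites_in (sample X w) K|)%R] <=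
    (tau^-1 * (1 - fine (mu K) + t * fine (mu K)) ^+ n)%:E)%E.
Proof.
move=> mK t0 tau0; set p := fine (mu K).
have muKE : mu K = p%:E by rewrite fineK// fin_num_measure.
have p01 : 0 <= p <= 1.
  by rewrite -!lee_fin -muKE probability_le1// measure_ge0.
pose B (b : bool) := if b then K else ~` K.
pose q (b : bool) := if b then p else 1 - p.
have mB b : measurable (B b) by case: b => //; exact: measurableC.
have q0 b : 0 <= q b by case: b; rewrite /q; case/andP: p01; rewrite ?subr_ge0.
have PB i b : P (X i @^-1` B b) = (q b)%:E.
  have := X_iid.1 i (B b) (mB b); rewrite /distribution /pushforward => ->.
  case: b; first exact: muKE.
  by rewrite /B probability_setC// muKE.
(* The event is split according to which sites lie in [K]; by independence each pattern has product
   probability. *)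
pose pat (f : {ffun 'I_n -> bool}) := [set w | forall i, B (f i) (X i w)].
have mpat f : measurable (pat f) by exact: (measurable_pattern (fun i => mB (f i))).
have Ppat f : P (pat f) = (\prod_i q (f i))%:E.
  rewrite (X_iid.2 (fun i => B (f i)) (fun i => mB (f i))) -prodEFin.
  apply: eq_bigr => i _; exact: PB.
pose F (f : {ffun 'I_n -> bool}) := tau <= t ^+ (\sum_i f i).
pose G f := if F f then pat f else set0.
have mG f : measurable (G f) by rewrite /G; case: ifP.
have NE w (f : {ffun 'I_n -> bool}) : pat f w ->
    #|sites_in (sample X w) K| = (\sum_i f i)%N.
  move=> fw; rewrite -sum1_card big_mkcond; apply: eq_bigr => i _ /=.
  rewrite inE; have := fw i; case: (f i) => /= H; first by rewrite mem_set.
  by rewrite memNset.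
have AE : [set w | (tau <= t ^+ #|sites_in (sample X w) K|)%R] = \bigcup_f G f.
  apply/seteqP; split=> [w /= tauN|w [f _]].
    pose f := [ffun i => X i w \in K].
    have fw : pat f w.
      move=> i; rewrite ffunE.
      case: (boolP (X i w \in K)) => [/set_mem|/negP Kw Xw]//.
      by apply: Kw; exact/mem_set.
    by exists f => //; rewrite /G /F -(NE w)// tauN.
  by rewrite /G /F; case: ifP => // Ff /NE /= ->.
have mA : measurable (\bigcup_f G f).
  by apply: fin_bigcup_measurable => //; exact: finite_finset.
rewrite AE; apply: le_trans (measure_sub_sum P mA mG (fun w => id)) _.
(* Expanding the power over all patterns exhibits it as the expectation of [t ^+ N]. *)
have -> : (1 - p + t * p) ^+ n =
    \sum_(f : {ffun 'I_n -> bool}) \prod_i (t ^+ f i * q (f i)).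
  rewrite -(bigA_distr_bigA (fun (i : 'I_n) (b : bool) => t ^+ b * q b)).
  rewrite prodr_const card_ord; congr (_ ^+ _).
  by rewrite big_bool /= expr1 expr0 mul1r addrC.
rewrite mulr_sumr -sumEFin; apply: lee_sum => f _.
rewrite /G; case: ifP => [Ff|_].
  change (P (pat f) <= (tau^-1 * \prod_i (t ^+ f i * q (f i)))%:E)%E.
  rewrite Ppat lee_fin big_split/= mulrA ler_peMl ?prodr_ge0//.
  by rewrite -expr_sum ler_pdivlMl// mulr1.
rewrite measure0 lee_fin; apply: mulr_ge0; first by rewrite invr_ge0 ltW.
by apply: prodr_ge0 => i _; rewrite mulr_ge0 ?exprn_ge0.
Qed.
(** Take [t = expR 1] and [tau = expR r] in the tail bound, then use [1 + x <= expR x] with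
    [x = (expR 1 - 1) * p]. *)
Lemma sites_in_many (K : set 'rV[R]_d) (r : R) : measurable K ->
  (P [set w | (r <= #|sites_in (sample X w) K|%:R)%R] <=
    (expR (- r + (expR 1 - 1) * (n%:R * fine (mu K))))%:E)%E.
Proof.
move=> mK; set p := fine (mu K).
have -> : [set w | (r <= #|sites_in (sample X w) K|%:R)%R] =
    [set w | (expR r <= expR 1 ^+ #|sites_in (sample X w) K|)%R].
  by apply/funext => w /=; rewrite -expRM_natl mulr1 ler_expR.
apply: le_trans (sites_in_tail mK (expR_ge0 1) (expR_gt0 r)) _.
have p0 : 0 <= p by rewrite fine_ge0.
rewrite lee_fin expRD expRN ler_pM2l ?invr_gt0 ?expR_gt0//.
rewrite [X in _ <= expR X]mulrCA expRM_natl -/p lerXn2r ?nnegrE ?expR_ge0//.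
  have e1 : 1 <= expR 1 :> R by rewrite -expR0 ler_expR.
  have p1 : p <= 1 by rewrite -lee_fin fineK ?fin_num_measure// probability_le1.
  by rewrite addr_ge0 ?subr_ge0// mulr_ge0 ?expR_ge0.
by apply: le_trans (expR_ge1Dx _); rewrite le_eqVlt; apply/orP; left; apply/eqP; ring.
Qed.

(** Take [t = 0] and [tau = 1]: as [0 ^+ 0 = 1], the power [0 ^+ N] indicates that no site lies in
    [K]. Then [1 - p <= expR (- p)]. *)
Lemma sites_in_none (K : set 'rV[R]_d) : measurable K ->
  (P [set w | forall i, ~ K (X i w)] <= (expR (- (n%:R * fine (mu K))))%:E)%E.
Proof.
move=> mK; set p := fine (mu K).
have -> : [set w | forall i, ~ K (X i w)] =
    [set w | (1 <= 0 ^+ #|sites_in (sample X w) K| :> R)%R].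
  apply/seteqP; split=> w /= H.
    rewrite (_ : sites_in _ _ = finset.set0) ?cards0 ?expr0//.
    by apply/setP => i; rewrite !inE; apply/negP => /set_mem; exact: H.
  move=> i Ki; move: H; rewrite expr0n cards_eq0.
  case: eqP => [/setP/(_ i)|_ /=]; last by rewrite ler10.
  by rewrite !inE mem_set.
apply: le_trans (sites_in_tail mK (lexx 0) ltr01) _.
rewrite invr1 mul1r mul0r addr0 lee_fin -/p -mulrN expRM_natl.
have p1 : p <= 1 by rewrite -lee_fin fineK ?fin_num_measure// probability_le1.
by rewrite lerXn2r ?nnegrE ?expR_ge0 ?subr_ge0//; exact: expR_ge1Dx.
Qed.
End binomial_tail.

(** * Boxes and two-sided bounds on the sampling distribution *)

Section boxes.
Variables (R : realType) (d : nat).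

(** Cubes stand in for Euclidean balls because their Lebesgue measure is an explicit product. *)
Definition box (z : 'rV[R]_d) (rho : R) : set 'rV[R]_d :=
  [set x | forall i, `[z ord0 i - rho, z ord0 i + rho]%classic (x ord0 i)].

Lemma boxP z rho x : box z rho x <-> forall i, `|x ord0 i - z ord0 i| <= rho.
Proof.
by split=> H i; have := H i; rewrite /= in_itv/= ler_distl.
Qed.

Lemma measurable_box z rho : measurable (box z rho).
Proof.
rewrite (_ : box z rho = \bigcap_(i in setT)
    (fun x => x ord0 i) @^-1` `[z ord0 i - rho, z ord0 i + rho]%classic).
  apply: fin_bigcap_measurable => // i _.
  have mc := measurable_coord i (@measurable_id _ 'rV[R]_d setT).
  by rewrite -[X in measurable X]setTI; apply: mc => //; exact: measurable_itv.
by apply/seteqP; split => [x h i _|x h i]; [exact: h|exact: (h i)].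
Qed.

Lemma lebesgue_rV_boxE z rho : 0 <= rho ->
  lebesgue_rV (box z rho) = ((2 * rho) ^+ d)%:E.
Proof.
move=> rho0.
rewrite /box (lebesgue_rV_box
  (A := fun i => `[z ord0 i - rho, z ord0 i + rho]%classic)); last first.
  by move=> i; exact: measurable_itv.
under eq_bigr => i _.
  rewrite lebesgue_measure_itv/= lte_fin.
  rewrite (_ : (if _ then _ else _) = (2 * rho)%:E).
    over.
  case: ltP => [_|]; first by rewrite -EFinB; congr EFin; ring.
  by move=> le0; congr EFin; lra.
by rewrite prodEFin prodr_const card_ord.
Qed.

Lemma nicely_behaving_bounds Omega (mu : probability 'rV[R]_d R) (x0 : 'rV[R]_d) :
  measurable Omega -> Omega x0 -> nicely_behaving Omega mu ->
  exists c1 c2 : R, [/\ 0 < c1, 0 < c2,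
    forall S, measurable S -> (mu S <= c2%:E * lebesgue_rV S)%E &
    forall S, measurable S -> S `<=` Omega -> (c1%:E * lebesgue_rV S <= mu S)%E].
Proof.
move=> mO Ox0 [p [mp p0 muE [c_lo [c_up [c_lo0 c_le pP]]]]].
set V := (fine _)^-1 in pP.
(* Positivity of the density at [x0] excludes the degenerate value [V = 0]. *)
have V0 : 0 < V.
  have /andP[_ pu] := pP x0 Ox0.
  by rewrite -(pmulr_rgt0 _ (lt_le_trans c_lo0 c_le)) (lt_le_trans (p0 _ Ox0)).
have mpS S : measurable S -> measurable_fun (S `&` Omega) (fun x => (p x)%:E).
  move=> mS; apply/measurable_EFinP; apply: measurable_funS mp => //.
exists (c_lo * V), (c_up * V); split=> [||S mS|S mS SO].
- exact: mulr_gt0.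
- by rewrite mulr_gt0// (lt_le_trans c_lo0).
- rewrite muE//; apply: (@le_trans _ _ (\int[lebesgue_rV (d := d)]_(x in S `&` Omega)
      (c_up * V)%:E)%E).
    apply: ge0_le_integral => //.
    + exact: measurableI.
    + by move=> x [_ Ox]; rewrite lee_fin ltW// p0.
    + exact: mpS.
    + by move=> x [_ Ox]; rewrite lee_fin; have /andP[] := pP x Ox.
  rewrite integral_cst//; last exact: measurableI.
  apply: lee_wpmul2l.
    by rewrite lee_fin mulr_ge0 ?(ltW V0)// (le_trans (ltW c_lo0)).
  by apply: le_measure; rewrite ?inE//; exact: measurableI.
- rewrite muE// setIidl// -integral_cst//.
  have mpS' := mpS S mS; rewrite setIidl// in mpS'.
  apply: ge0_le_integral => //.
  + by move=> x _; rewrite lee_fin mulr_ge0 ?ltW.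
  + by move=> x /SO Ox; rewrite lee_fin; have /andP[] := pP x Ox.
Qed.
End boxes.

(** * Unisolvent grids in a cone *)

Section unisolvence.
Variables (R : realType) (d m : nat).
Local Notation A := #|multi_indices d m|.

Lemma mpol_affine_inj (I : Type) (y : I -> 'rV[R]_d) x0 h : h != 0 ->
  (forall v : 'rV[R]_A, (forall i, mpol v (y i) = 0) -> v = 0) ->
  forall v : 'rV[R]_A, (forall i, mpol v (x0 + h *: y i) = 0) -> v = 0.
Proof.
move=> h0 yinj v vy.
have /(poly_space_affine x0 h)/poly_spaceP[u uE] : poly_space m (mpol v).
  by apply/poly_spaceP; exists v.
have u0 : u = 0 by apply: yinj => i; rewrite -uE vy.
apply: mpol_inj; apply/funext => x.
have /(congr1 (fun f => f (h^-1 *: (x - x0)))) := uE.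
by rewrite scalerA divff// scale1r addrC subrK => ->; rewrite u0 !mpol0.
Qed.

(** Unisolvence of the nodes is nonvanishing of their unweighted Gram determinant, which is
    continuous in the nodes, hence an open condition. *)
Lemma grid_stable N (z : 'I_N -> 'rV[R]_d) :
  (forall v : 'rV[R]_A, (forall i, mpol v (z i) = 0) -> v = 0) ->
  exists2 rho : R, 0 < rho & forall y : 'I_N -> 'rV[R]_d,
    (forall i, box (z i) rho (y i)) ->
    forall v : 'rV[R]_A, (forall i, mpol v (y i) = 0) -> v = 0.
Proof.
move=> zinj.
pose D (Z : 'M[R]_(N, d)) := \det (gram (fun=> 1) (design m (fun i => row i Z))).
have DP Z : D Z != 0 <->
    (forall v : 'rV[R]_A, (forall i, mpol v (row i Z) = 0) -> v = 0).
  rewrite /D det_gram_neq0; last by move=> _; exact: ler01.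
  by split=> H v vZ; apply: H => i; have := vZ i; rewrite mul_designE mul1r.
pose Z0 := \matrix_(i, c) z i ord0 c.
have row0 i : row i Z0 = z i by apply/rowP => c; rewrite !mxE.
have D0 : D Z0 != 0 by apply/DP => v vZ; apply: zinj => i; rewrite -row0.
have Dc : {for Z0, continuous D}.
  pose Q (f : 'M[R]_(N, d) -> R) := {for Z0, continuous f}.
  have QC c : Q (fun=> c) by exact: cst_continuous.
  have QD f g : Q f -> Q g -> Q (fun x => f x + g x).
    by move=> fc gc; exact: (cvgD fc gc).
  have QM f g : Q f -> Q g -> Q (fun x => f x * g x).
    by move=> fc gc; exact: (cvgM fc gc).
  have Qmon i j : Q (fun Z => design m (fun i => row i Z) i j).
    under eq_fun do rewrite !mxE.
    apply: (@fun_ring_prod _ _ Q QC QM _ _ _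
      (fun c Z => row i Z ord0 c ^+ exponent j c)) => c.
    elim: (nat_of_ord _) => [|e IH].
      by under eq_fun do rewrite expr0; exact: QC.
    under eq_fun do rewrite exprS.
    by apply/QM => //; under eq_fun do rewrite mxE; exact: coord_continuous.
  apply: (@fun_ring_det _ _ Q QC QD QM _
    (fun Z => gram (fun=> 1) (design m (fun i => row i Z)))) => j l.
  under eq_fun do rewrite mxE.
  apply: (@fun_ring_sum _ _ Q QC QD _ _ _ (fun i Z =>
    1 * (design m (fun i => row i Z) i j * design m (fun i => row i Z) i l))) => i.
  by apply/QM => //; apply/QM.
have /nbhs_ballP[e /= e0 eD] : nbhs Z0 (D @^-1` [set t | t != 0]).
  by apply: Dc; apply: open_nbhs_nbhs; split=> //; exact: open_neq.
exists (e / 2); first by rewrite divr_gt0.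
move=> y yz v vy.
apply: (DP (\matrix_(i, c) y i ord0 c)).1 => [|i].
  apply: eD; split=> // i c; rewrite !mxE /ball/= distrC.
  have /boxP/(_ c) := yz i; move=> /le_lt_trans; apply.
  by rewrite ltr_pdivrMr// ltr_pMr// ltr1n.
by rewrite -(vy i); congr mpol; apply/rowP => c; rewrite !mxE.
Qed.

(** The directions strictly inside the cone at [x0] with length below [s / 2] form an open set
    containing [(s / 4) *: xi], since [cos theta < 1]. The length bound leaves room for the radius
    [s / 4 * h] of the ball of evaluation points. *)
Lemma cone_open (Omega : set 'rV[R]_d) (x0 : 'rV[R]_d) s :
  interior_cone Omega -> Omega x0 -> 0 < s ->
  exists (r eta : R) (u : 'rV[R]_d), [/\ 0 < r, 0 < eta &
    forall y, box u eta y -> enorm y < s / 2 /\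
      forall l, 0 <= l -> l * (s / 2) <= r -> Omega (x0 + l *: y)].
Proof.
move=> [theta [r [theta0 theta_pi r0 cone]]] Ox0 s0.
have [xi xi1 xiO] := cone x0 Ox0.
have cos_ge0 : 0 <= cos theta by rewrite cos_ge0_pihalf// (ltW theta_pi) andbT; lra.
have cos1 : cos theta < 1.
  rewrite -(@cos0 R) ltr_cos ?in_itv/= ?lexx ?pi_ge0//.
  by rewrite (ltW theta0)/=; have := pi_gt0 R; lra.
pose g y := edot y xi - cos theta * enorm y.
have gc : continuous g.
  move=> y; apply: (cvgB (@edot_continuous _ _ xi y)).
  exact: (cvgM (cvg_cst _) (@enorm_continuous _ _ y)).
pose V := [set y | 0 < g y] `&` [set y | enorm y < s / 2].
have oV : open V.
  apply: openI.
    by move/continuousP: gc => /(_ [set t | 0 < t]); apply; exact: open_gt.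
  have /continuousP/(_ [set t | t < s / 2]) := @enorm_continuous R d.
  by apply; exact: open_lt.
pose u := (s / 4) *: xi.
have uV : V u.
  have xx : edot xi xi = 1 by rewrite -sqr_enorm xi1 expr1n.
  have s4 : 0 < s / 4 by rewrite divr_gt0.
  split; rewrite /= /g ?edotZl enormZ xi1 gtr0_norm// ?xx !mulr1; last lra.
  by rewrite subr_gt0 gtr_pMl.
have /nbhs_ballP[e /= e0 eV] : nbhs u V by exact: open_nbhs_nbhs.
exists r, (e / 2), u; split=> //; first by rewrite divr_gt0.
move=> y yu.
have [/= gy ys] : V y.
  apply: eV; split=> // i c; rewrite ord1 /ball/= distrC.
  have /boxP/(_ c) := yu; move=> /le_lt_trans; apply.
  by rewrite ltr_pdivrMr// ltr_pMr// ltr1n.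
split=> // l l0 lr.
have y0 : 0 < enorm y.
  rewrite lt0r enorm_ge0 andbT; apply/eqP => /enorm0_eq0 y0; move: gy.
  by rewrite /g y0 enorm0 mulr0 subr0 /edot big1 ?ltxx// => i _; rewrite mxE mul0r.
have -> : l *: y = (l * enorm y) *: ((enorm y)^-1 *: y).
  by rewrite scalerA mulfK// gt_eqF.
apply: xiO.
- by rewrite enormZ ger0_norm ?invr_ge0 ?enorm_ge0// mulVf// gt_eqF.
- by rewrite edotZl mulrC ler_pdivlMr//; move: gy; rewrite /g subr_gt0 => /ltW.
- rewrite mulr_ge0 ?enorm_ge0//=; apply: le_trans lr.
  by rewrite ler_wpM2l// ltW.
Qed.

Lemma cone_grid (Omega : set 'rV[R]_d) (x0 : 'rV[R]_d) s :
  interior_cone Omega -> Omega x0 -> 0 < s ->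
  exists (r rho : R) (N : nat) (z : 'I_N -> 'rV[R]_d), [/\ 0 < r, 0 < rho,
    (forall i y, box (z i) rho y -> enorm y < s / 2 /\
      forall l, 0 <= l -> l * (s / 2) <= r -> Omega (x0 + l *: y)) &
    forall y : 'I_N -> 'rV[R]_d, (forall i, box (z i) rho (y i)) ->
      forall v : 'rV[R]_A, (forall i, mpol v (y i) = 0) -> v = 0].
Proof.
move=> cone Ox0 s0; have [r [eta [u [r0 eta0 uO]]]] := cone_open cone Ox0 s0.
(* The grid uses offsets in [[0, eta / 2)] from [u]; the other [eta / 2] is left for moving the
   nodes, whence the minimum with [rho] below. *)
pose t (i : 'I_d) (l : 'I_m.+1) : R := u ord0 i + eta / 2 * (l%:R / m.+1%:R).
pose L := {ffun 'I_d -> 'I_m.+1}.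
pose z (k : 'I_#|L|) : 'rV[R]_d := \row_i t i ((enum_val k : L) i).
have [|rho rho0 zrho] := @grid_stable #|L| z.
  move=> v vz; apply: (@mpol_grid_inj _ _ _ t) => [i a b|l].
    have eta2 : eta / 2 != 0 by rewrite gt_eqF ?divr_gt0.
    have m1 : (m.+1%:R : R)^-1 != 0 by rewrite invr_eq0 pnatr_eq0.
    move=> /addrI/(mulfI eta2)/(mulIf m1)/eqP; rewrite eqr_nat => /eqP.
    exact: val_inj.
  have := vz (enum_rank l); congr (mpol v _ = 0).
  by apply/rowP => i; rewrite !mxE enum_rankK.
exists r, (Num.min rho (eta / 2)), #|L|, z; split=> //.
- by rewrite lt_min rho0 divr_gt0.
- move=> k y /boxP yz; apply: uO; apply/boxP => i.
  have := yz i; rewrite le_min => /andP[_ yzi].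
  rewrite -(subrKA (z k ord0 i)) (le_trans (ler_normD _ _))// [leRHS]splitr lerD//.
  rewrite mxE /t addrC addKr ger0_norm ?mulr_ge0 ?divr_ge0 ?(ltW eta0)//.
  rewrite ler_piMr ?divr_ge0 ?(ltW eta0)// ler_pdivrMr// mul1r ler_nat.
  exact/ltnW/ltn_ord.
- move=> y yz; apply: zrho => k; apply/boxP => i.
  by have /boxP/(_ i) := yz k; rewrite le_min => /andP[].
Qed.

(** The sites picked in the scaled boxes rescale to a perturbed grid, hence are unisolvent. Each is
    at distance less than [s / 4 * h + s / 2 * h < s * h] from [xi], so its weight is positive and
    the polynomial must vanish there. *)
Lemma mls_gram_neq0_boxes n (X : 'I_n -> 'rV[R]_d) Phi s x0 h h0
    N (z : 'I_N -> 'rV[R]_d) rho xi :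
  (forall x, 0 <= Phi x) -> (forall x, enorm x < s -> 0 < Phi x) ->
  0 < s -> 0 < h0 -> h0 <= h ->
  (forall i y, box (z i) rho y -> enorm y < s / 2) ->
  (forall y : 'I_N -> 'rV[R]_d, (forall i, box (z i) rho (y i)) ->
      forall v : 'rV[R]_A, (forall i, mpol v (y i) = 0) -> v = 0) ->
  (forall j, exists i, box (x0 + h0 *: z j) (h0 * rho) (X i)) ->
  eball x0 (s / 4 * h) xi ->
  \det (mls_gram m (scaled_weight Phi h) X xi) != 0.
Proof.
move=> Phi0 Phis s0 h00 h0h zs zinj /choice[i iP] xix0.
apply/mls_gram_neq0 => [x|v vX]; first exact: Phi0.
pose y j := h0^-1 *: (X (i j) - x0).
have Xy j : X (i j) = x0 + h0 *: y j.
  by rewrite /y scalerA divff ?gt_eqF// scale1r addrC subrK.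
have yz j : box (z j) rho (y j).
  apply/boxP => c; have /boxP/(_ c) := iP j.
  rewrite Xy !mxE opprD addrACA subrr add0r -mulrBr normrM gtr0_norm//.
  by rewrite ler_pM2l.
apply: (mpol_affine_inj (x0 := x0) (lt0r_neq0 h00) (zinj y yz)) => j.
rewrite -Xy; have /eqP := vX (i j); rewrite mulf_eq0 => /orP[|/eqP//].
rewrite gt_eqF// /scaled_weight; apply: Phis.
have hgt0 : 0 < h by exact: lt_le_trans h0h.
rewrite enormZ gtr0_norm ?invr_gt0// ltr_pdivrMl//.
have -> : xi - X (i j) = (xi - x0) - h0 *: y j by rewrite Xy opprD addrA.
apply: le_lt_trans (ler_enormD _ _) _; rewrite enormN enormZ gtr0_norm//.
have := zs j _ (yz j); move: xix0; rewrite /eball/= => le1 lt2.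
have : h0 * enorm (y j) <= h * (s / 2).
  by rewrite ler_pM ?enorm_ge0// ltW.
have : 0 < h * s by rewrite mulr_gt0.
lra.
Qed.
End unisolvence.

(** * The conditional estimate *)

Section events.
Variables (R : realType) (d k m n : nat) (dT : measure_display)
  (T : measurableType dT) (P : probability T R)
  (X : 'I_n.+1 -> {RV P >-> 'rV[R]_d}) (Omega : set 'rV[R]_d)
  (s : R) (Phi f : 'rV[R]_d -> R) (gamma1 gamma2 : R) (x0 : 'rV[R]_d).
Hypotheses (Omega_compact : compact Omega) (Omega_x0 : Omega x0) (s_gt0 : 0 < s)
  (Phi_weight : admissible_weight k s Phi).
Local Notation h w := (fill_distance Omega (sample X w)).
Local Notation delta := (fun w => s / 4 * h w).
Local Notation smooth := [set w | mls_smooth_on m (scaled_weight Phi (h w))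
  (sample X w) f k (eball x0 (delta w))].
Local Notation EI := (event_I X Omega s gamma1 gamma2 x0).

Let Omega0 : Omega !=set0. Proof. by exists x0. Qed.
Let mX i : measurable_fun setT (X i). Proof. exact: measurable_funPT. Qed.

Lemma measurable_delta : measurable_fun setT delta.
Proof. by apply: measurable_funM => //; exact: measurable_fill_distance. Qed.

Lemma smooth_gramP w : smooth w <-> forall xi, eball x0 (delta w) xi ->
  \det (mls_gram m (scaled_weight Phi (h w)) (sample X w) xi) != 0.
Proof.
have [Phik Phi0 _ _] := Phi_weight.
apply: mls_smooth_onP => [x|]; first exact: Phi0.
have := Ck_affine (h w)^-1 0 Phik; congr (Ck _ _ _).
by apply/funext => x; rewrite subr0.
Qed.

Lemma measurable_smooth : measurable smooth.
Proof.
have [Phik _ _ _] := Phi_weight.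
have Phi00 : Ck 0 setT Phi by split=> // x Ux; exact: Ck_continuous Phik Ux.
have := measurable_nonvanishing_gram mX Omega_compact Omega0 m x0 Phi00
  (divr_ge0 (ltW s_gt0) (ler0n _ 4)).
by congr measurable; apply/funext => w; apply/propext; rewrite smooth_gramP.
Qed.

Lemma measurable_event_I : measurable EI.
Proof.
have mc := measurable_card_sites mX Omega_compact Omega0 x0 s.
rewrite (_ : EI = [set w | gamma1 * ln n.+1%:R <=
    #|sites_in (sample X w) (eball x0 (s * h w))|%:R] `&`
    [set w | #|sites_in (sample X w) (eball x0 (s * h w))|%:R <=
    gamma2 * ln n.+1%:R]).
  by apply: measurableI; apply: measurable_ler_set.
by apply/funext => w; apply/propext; split=> /andP.
Qed.

Lemma measurable_eball r : measurable (eball x0 r).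
Proof.
apply: closed_measurable_rV.
have /continuous_closedP := @enormB_continuous R d x0.
by move=> /(_ [set t | t <= r]); apply; exact: closed_le.
Qed.

(** Trades the random scale [h] for the deterministic [h0]: the two error terms concern fixed sets,
    for which binomial tails are available. *)
Lemma event_I_bound (N : nat) (z : 'I_N -> 'rV[R]_d) rho h0 : 0 < h0 ->
  (forall i y, box (z i) rho y -> enorm y < s / 2) ->
  (forall y : 'I_N -> 'rV[R]_d, (forall i, box (z i) rho (y i)) ->
      forall v : 'rV[R]_#|multi_indices d m|,
        (forall i, mpol v (y i) = 0) -> v = 0) ->
  (P EI <= P (smooth `&` EI) +
    (P [set w | (gamma1 * ln n.+1%:R <=
       #|sites_in (sample X w) (eball x0 (s * h0))|%:R)%R] +
     \sum_j P [set w | forall i, ~ box (x0 + h0 *: z j) (h0 * rho) (X i w)]))%E.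
Proof.
move=> h00 zs zinj.
pose many := [set w | gamma1 * ln n.+1%:R <=
  #|sites_in (sample X w) (eball x0 (s * h0))|%:R].
pose none j := [set w | forall i, ~ box (x0 + h0 *: z j) (h0 * rho) (X i w)].
have mmany : measurable many.
  apply: measurable_ler_set => //; apply: measurable_sites_in.
  exact: measurable_eball.
have mnone j : measurable (none j).
  apply: (@measurable_pattern _ _ _ _ _ P X
    (fun i => ~` box (x0 + h0 *: z j) (h0 * rho))) => i.
  by apply: measurableC; exact: measurable_box.
have mbad : measurable (\bigcup_j none j).
  by apply: fin_bigcup_measurable => //; exact: finite_finset.
have mSI : measurable (smooth `&` EI).
  by apply: measurableI; [exact: measurable_smooth|exact: measurable_event_I].
apply: (@le_trans _ _ (P ((smooth `&` EI) `|` (many `|` \bigcup_j none j)))).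
  apply: le_measure; rewrite ?inE.
  - exact: measurable_event_I.
  - by apply: measurableU => //; exact: measurableU.
  (* If [h < h0], the sites counted by [EI] all lie in the larger ball of radius [s * h0], which is
     then crowded. *)
  move=> w EIw; have [hh|hh] := leP h0 (h w); last first.
    right; left; rewrite /many/=; have /andP[+ _] := EIw; move/le_trans; apply.
    rewrite ler_nat; apply/subset_leq_card/fintype.subsetP => i; rewrite !inE.
    rewrite /eball/= => Xi; apply: le_trans Xi _.
    by rewrite ler_pM2l// ltW.
  have [[j jw]|H] := pselect (exists j, none j w).
    by right; right; exists j.
  left; split=> //; apply/smooth_gramP => xi xix0.
  have [_ Phi0 _ Phis] := Phi_weight.
  apply: (mls_gram_neq0_boxes Phi0 Phis s_gt0 h00 hh zs zinj _ xix0) => j.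
  by apply: contrapT => Hj; apply: H; exists j => i Xi; apply: Hj; exists i.
apply: le_trans (measureU2 _ _ _) _ => //; first exact: measurableU.
apply: leeD => //; apply: le_trans (measureU2 _ _ _) _ => //.
by apply: leeD => //; exact: (measure_sub_sum P).
Qed.
End events.

(* If [expR (phi * L) <= 2] the bound is vacuous; otherwise [phi] is so small that
   [expR (c * L) > 4] and [N.+1 * expR (- (c3 * L)) <= expR (- (phi * L))]. *)
Lemma conditional_tail (R : realType) (N : nat) (c c3 L A pI pS phi : R) :
  0 < phi -> phi <= c / 2 -> phi <= c3 / (2 * N.+1%:R) -> 1 <= A -> 0 <= pS -> 0 < pI ->
  1 - 2 / expR (c * L) <= pI ->
  (0 < L -> pI <= pS + N.+1%:R * expR (- (c3 * L))) ->
  1 - 2 * A ^+ 2 / expR (phi * L) <= pS / pI.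
Proof.
move=> phi0 phic phic3 A1 pS0 pI0 pIc pIS; set q := expR (phi * L).
have q0 : 0 < q by exact: expR_gt0.
have A2 : 1 <= A ^+ 2 by rewrite exprn_ege1.
have [q2|q2] := leP q 2.
  apply: (@le_trans _ _ 0); last by rewrite divr_ge0// ltW.
  by rewrite subr_le0 ler_pdivlMr// mul1r; lra.
have L0 : 0 < L.
  rewrite ltNge; apply/negP => L0; move: q2; rewrite ltNge => /negP; apply.
  apply: (@le_trans _ _ 1); last by lra.
  by rewrite -expR0 ler_expR mulr_ge0_le0// ltW.
have qc : q ^+ 2 <= expR (c * L).
  rewrite -expRM_natl ler_expR mulrA ler_pM2r//; lra.
have pI2 : 1 / 2 <= pI.
  apply: le_trans pIc; have e0 := expR_gt0 (c * L).
  suff : 2 / expR (c * L) <= 1 / 2 by lra.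
  rewrite ler_pdivrMr//; nra.
(* As [q > 2], [N.+1 <= 2 ^+ N.+1 <= q ^+ N.+1], so [N.+1 * q] is at most [q] to the power
   [2 * N.+1], which the bound on [phi] by [c3] keeps below [expR (c3 * L)]. *)
have qN : N.+1%:R * expR (- (c3 * L)) <= q^-1.
  rewrite expRN ler_pdivrMr ?expR_gt0// mulrC ler_pdivlMr//.
  apply: (@le_trans _ _ (q ^+ N.+1 * q ^+ N.+1)).
    apply: ler_pM => //; first exact: ltW.
      apply: (@le_trans _ _ (2 ^+ N.+1)).
        by rewrite -natrX ler_nat ltnW// ltn_expl.
      by rewrite lerXn2r ?nnegrE ?ltW.
    by rewrite ler_eXnr// ltW// (lt_trans _ q2)// ltr1n.
  rewrite -exprD -expRM_natl ler_expR mulrA ler_pM2r//.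
  move: phic3; rewrite ler_pdivlMr ?mulr_gt0// => phi_le; apply: le_trans phi_le.
  by rewrite addnn -mul2n natrM mulrC.
have pS_ge : pI - q^-1 <= pS.
  by have := pIS L0; lra.
(* The loss [q^-1] is divided by [pI >= 1 / 2], whence the factor 2; [A ^+ 2 >= 1] absorbs the
   rest. *)
rewrite ler_pdivlMr//.
have qi0 : 0 < q^-1 by rewrite invr_gt0.
have : q^-1 <= A ^+ 2 * q^-1 by rewrite ler_peMl// ltW.
nra.
Qed.

Lemma pos_root_exists (R : realType) (d : nat) (y : R) : (0 < d)%N -> 0 < y ->
  exists2 h : R, 0 < h & h ^+ d = y.
Proof.
move=> d0 y0; exists (y `^ d%:R^-1); first exact: powR_gt0.
by rewrite -powR_mulrn ?powR_ge0// -powRrM mulVf ?powRr1 ?ltW// pnatr_eq0 -lt0n.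
Qed.

Theorem theorem3 (R : realType) (d k : nat) (hd : (0 < d)%N) (hk : (1 <= k)%N)
  (Omega : set 'rV[R]_d) (Omega_compact : compact Omega)
  (Omega_cone : interior_cone Omega)
  (mu : probability 'rV[R]_d R) (mu_nice : nicely_behaving Omega mu)
  (* for every n, an i.i.d. sample of size n on some probability space *)
  (dT : nat -> measure_display) (T : forall n, measurableType (dT n))
  (P : forall n, probability (T n) R)
  (X : forall n, 'I_n -> {RV (P n) >-> 'rV[R]_d})
  (X_iid : forall n, iid_sample (X n) mu)
  (f : 'rV[R]_d -> R)
  (s : R) (s_gt0 : 0 < s) (Phi : 'rV[R]_d -> R)
  (Phi_weight : admissible_weight k s Phi)
  (gamma1 gamma2 : R) (gamma1_gt0 : 0 < gamma1) (gamma12 : gamma1 <= gamma2)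
  (c : R) (c_gt0 : 0 < c)
  (event_I_likely : forall n xhat, (0 < n)%N -> Omega xhat ->
     ((1 - 2 / n%:R `^ c)%:E <=
        P n (event_I (X n) Omega s gamma1 gamma2 xhat))%E)
  (x0 : 'rV[R]_d) (Omega_x0 : Omega x0) :
  exists a b phi : R, [/\ 0 < a, a <= b, 0 < phi &
    forall n, (0 < n)%N ->
      let EI := event_I (X n) Omega s gamma1 gamma2 x0 in
      (0 < P n EI)%E ->
      exists delta0 : T n -> R,
        [/\ measurable_fun setT delta0,
            (forall w, let h := fill_distance Omega (sample (X n) w) in
               a * h <= delta0 w <= b * h),
            measurable (event_smooth (X n) Omega Phi f k x0 delta0) &
            1 - 2 * #|multi_indices d k.-1|%:R ^+ 2 / n%:R `^ phi <=
              cond_prob (P n) (event_smooth (X n) Omega Phi f k x0 delta0) EI]].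
Proof.
have [r [rho [N [z [r0 rho0 zO zinj]]]]] :=
  cone_grid k.-1 Omega_cone Omega_x0 s_gt0.
have mO : measurable Omega.
  apply: closed_measurable_rV; apply: compact_closed Omega_compact.
  exact: norm_hausdorff.
have [c1 [c2 [c10 c20 mu_le mu_ge]]] := nicely_behaving_bounds mO Omega_x0 mu_nice.
have e1 : 0 < expR 1 - 1 :> R by rewrite subr_gt0 -[ltLHS]expR0 ltr_expR.
(* The ball of radius [s * h0] lies in the box of half-side [s * h0], so [kappa * (n * h0 ^+ d)]
   bounds [expR 1 - 1] times the expected number of its sites. *)
pose kappa := (expR 1 - 1) * (c2 * (2 * s) ^+ d).
have kappa0 : 0 < kappa by rewrite !mulr_gt0// exprn_gt0// mulr_gt0.
(* The first bound keeps the scaled boxes in the cone (as [ln n <= n]); the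
   second one keeps [(expR 1 - 1)] times the expected number of sites in
   [eball x0 (s * h0)] below [gamma1 / 2 * ln n]. *)
pose eps := Num.min ((2 * r / s) ^+ d) (gamma1 / 2 / kappa).
have eps0 : 0 < eps.
  by rewrite lt_min exprn_gt0 !divr_gt0// mulr_gt0.
(* With [n * h0 ^+ d = eps * ln n], each scaled box expects at least [c4 * ln n] sites. *)
pose c4 := c1 * (2 * rho) ^+ d * eps.
have c40 : 0 < c4 by rewrite !mulr_gt0// exprn_gt0// mulr_gt0.
(* A common decay rate for the [N.+1] bad events: the crowded ball and the [N] missed boxes. *)
pose c3 := Num.min (gamma1 / 2) c4.
have c30 : 0 < c3 by rewrite lt_min c40 divr_gt0.
pose phi := Num.min (c / 2) (c3 / (2 * N.+1%:R)).
have phi0 : 0 < phi by rewrite lt_min !divr_gt0 ?mulr_gt0.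
exists (s / 4), (s / 4), phi; split=> //; first by rewrite divr_gt0.
case=> // n _ EI EI0.
exists (fun w => s / 4 * fill_distance Omega (sample (X n.+1) w)).
have mS := measurable_smooth k.-1 (X n.+1) f Omega_compact Omega_x0 s_gt0 Phi_weight.
have mEI : measurable EI.
  exact: (measurable_event_I (X n.+1) s gamma1 gamma2 Omega_compact Omega_x0).
split=> //.
- exact: (measurable_delta (X n.+1) s Omega_compact Omega_x0).
- by move=> w /=; rewrite !lexx.
have nE x : n.+1%:R `^ x = expR (x * ln n.+1%:R) by rewrite /powR pnatr_eq0.
rewrite nE /cond_prob.
apply: (@conditional_tail _ N c c3).
- exact: phi0.
- by rewrite ge_min lexx.
- by rewrite ge_min lexx orbT.
- by rewrite ler1n card_multi_indices_gt0.
- by rewrite fine_ge0.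
- by rewrite -lte_fin fineK ?fin_num_measure.
- rewrite -lee_fin fineK ?fin_num_measure// -nE.
  exact: event_I_likely.
move=> L0.
(* The scale is introduced only for [ln n > 0], where it is positive; for [n = 1] the claimed bound
   is vacuous. *)
have [h0 h00 h0E] := pos_root_exists hd (divr_gt0 (mulr_gt0 eps0 L0) (ltr0Sn R n)).
have nh0 : n.+1%:R * h0 ^+ d = eps * ln n.+1%:R.
  by rewrite h0E mulrC divfK// pnatr_eq0.
have h0r : h0 * (s / 2) <= r.
  suff : h0 <= 2 * r / s by rewrite ler_pdivlMr//; lra.
  rewrite -(@ler_pXn2r _ d)// ?nnegrE ?divr_ge0 ?mulr_ge0 ?(ltW h00) ?(ltW r0)
    ?(ltW s_gt0)//.
  rewrite h0E; apply: (@le_trans _ _ eps); last by rewrite ge_min lexx.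
  rewrite ler_pdivrMr// ler_pM2l//.
  exact/ltW/ln_sublinear.
have := event_I_bound (X n.+1) f gamma1 gamma2 Omega_compact Omega_x0 s_gt0
  Phi_weight h00 (fun i y yz => (zO i y yz).1) zinj.
set bad := (_ + \sum__ _)%E; set good := P n.+1 _ => le1.
have bad_le : (bad <= (N.+1%:R * expR (- (c3 * ln n.+1%:R)))%:E)%E.
  rewrite -natr1 mulrDl mul1r addrC EFinD; apply: leeD.
    apply: le_trans (sites_in_many (X_iid n.+1) _ (measurable_eball _ _)) _.
    rewrite lee_fin ler_expR.
    have muK : fine (mu (eball x0 (s * h0))) <= c2 * (2 * (s * h0)) ^+ d.
      rewrite -lee_fin fineK ?fin_num_measure//; last exact: measurable_eball.
      apply: le_trans (_ : mu (box x0 (s * h0)) <= _)%E.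
        apply: le_measure; rewrite ?inE.
        - exact: measurable_eball.
        - exact: measurable_box.
        move=> x xx0; apply/boxP => i; apply: le_trans xx0.
        by have := ler_coord_enorm (x - x0) i; rewrite !mxE.
      apply: le_trans (mu_le _ (measurable_box _ _)) _.
      by rewrite lebesgue_rV_boxE// mulr_ge0// ltW.
    have : (expR 1 - 1) * (n.+1%:R * fine (mu (eball x0 (s * h0)))) <=
        gamma1 / 2 * ln n.+1%:R.
      apply: (@le_trans _ _ (kappa * (n.+1%:R * h0 ^+ d))).
        rewrite /kappa -[_ * _ * (n.+1%:R * _)]mulrA ler_pM2l//.
        rewrite [_ * (n.+1%:R * _)]mulrCA ler_pM2l ?ltr0Sn//.
        by rewrite -mulrA -exprMn -[2 * s * h0]mulrA.
      rewrite nh0 mulrA ler_pM2r// -ler_pdivlMl// mulrC.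
      by rewrite ge_min lexx orbT.
    have : c3 * ln n.+1%:R <= gamma1 / 2 * ln n.+1%:R.
      by rewrite ler_pM2r// ge_min lexx.
    lra.
  rewrite mulr_natl -[X in _ *+ X]card_ord -sumr_const -sumEFin.
  apply: lee_sum => j _.
  apply: le_trans (sites_in_none (X_iid n.+1) (measurable_box _ _)) _.
  rewrite lee_fin ler_expR lerN2.
  (* The lower density bound holds only inside [Omega]; the scaled box lies there by the cone
     condition, as [h0 * (s / 2) <= r]. *)
  have muB : c1 * (2 * (h0 * rho)) ^+ d <= fine (mu (box (x0 + h0 *: z j) (h0 * rho))).
    rewrite -lee_fin fineK ?fin_num_measure//; last exact: measurable_box.
    rewrite EFinM -(lebesgue_rV_boxE (x0 + h0 *: z j)); last by rewrite mulr_ge0// ltW.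
    apply: mu_ge; first exact: measurable_box.
    move=> x /boxP xB; rewrite -[x](subrK x0) addrC.
    rewrite -[x - x0]scale1r -(divff (lt0r_neq0 h00)) -scalerA.
    apply: (zO j _ _).2 => //; last exact: ltW.
    apply/boxP => i.
    have -> : (h0^-1 *: (x - x0)) ord0 i - z j ord0 i =
        h0^-1 * (x ord0 i - (x0 + h0 *: z j) ord0 i).
      by rewrite !mxE; field; rewrite gt_eqF.
    by rewrite normrM gtr0_norm ?invr_gt0// ler_pdivrMl.
  apply: (@le_trans _ _ (c4 * ln n.+1%:R)).
    by rewrite ler_pM2r// ge_min lexx orbT.
  rewrite /c4 -mulrA -nh0 mulrCA ler_pM2l ?ltr0Sn//; apply: le_trans muB.
  by rewrite -mulrA -exprMn -[2 * rho * h0]mulrA [rho * h0]mulrC.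
rewrite -lee_fin EFinD !fineK ?fin_num_measure//; last exact: measurableI.
by apply: le_trans le1 _; exact: leeD.
Qed.
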